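(* Let $A$ be a skew-gentle algebra and $(S,M,\mathcal O,G)$ the orbifold dissection induced by the generalised ribbon graph $G$ of $A$. Denote by $c_k$ the number of (possibly degenerate) interior polygons of $G$ with $k$ edges and let $\Lambda$ be the gentle algebra obtained from $A$ by deleting the special loops. Then the $q$-Cartan matrix $C_A(q)$ has determinant $$\det C_A(q)=\det C_\Lambda(q)=\prod_{k\ge1}\bigl(1-(-q)^k\bigr)^{c_k}.$$
   Context: **$q$-Cartan matrix.** If $A=KQ/I$ with $I$ generated by homogeneous relations, $A$ is graded by path length, and $C_A(q)=(c_{ij}(q))$ is the matrix indexed by vertices with $c_{ij}(q)=\sum_n\dim_K(e_iAe_j)_n\,q^n\in\mathbb Z[q]$, where $(e_iAe_j)_n$ is the degree $n$ component. For a skew-gentle algebra the path-length grading is that of the admissible presentation $KQ^{sg}/I^{sg}$ below. An *interior polygon* is a (possibly degenerate) polygon of the dissection with no boundary edges; special edges are counted once. **Algebras.** $K$ is an algebraically closed field with $\operatorname{char}K\neq 2$. Paths in a quiver $Q=(Q_0,Q_1,s,t)$ are written $\alpha_1\cdots\alpha_n$ with $t(\alpha_j)=s(\alpha_{j+1})$; $e_i$ is the trivial path at $i$. An algebra is *gentle* if it is Morita equivalent to $KQ/I$ with $Q$ finite and: every vertex has at most two incoming and at most two outgoing arrows; for each arrow $\alpha$ there is at most one arrow $\beta$ with $t(\alpha)=s(\beta)$, $\alpha\beta\in I$ and at most one $\gamma$ with $t(\gamma)=s(\alpha)$, $\gamma\alpha\in I$; for each $\alpha$ there is at most one $\beta'$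 with $\alpha\beta'\notin I$ and at most one $\gamma'$ with $\gamma'\alpha\notin I$; $I$ is generated by paths of length 2; $I$ is admissible. $A$ is *skew-gentle* if it is Morita equivalent to $K\hat Q/\hat I$ with $\hat Q_0=Q_0$, $\hat Q_1=Q_1\cup S$, $S$ a set of loops (special loops), $\hat I=\langle I\cup\{\varepsilon^2-\varepsilon:\varepsilon\in S\}\rangle$, $\Lambda=KQ/I$ gentle, and such that each vertex $i=s(\varepsilon)$, $\varepsilon\in S$ (a *special* vertex; $Sp$ is the set of these) carries only one special loop, is the start or the end of exactly one arrow of $Q_1$, and if $\alpha,\beta\in Q_1$ with $t(\alpha)=i=s(\beta)$ then $\alpha\beta\in I$. **Admissible presentation.** For $i\in Q_0$ put $Q_0^{sg}(i)=\{i^+,i^-\}$ if $i\in Sp$ and $\{i\}$ otherwise; $Q_0^{sg}=\bigcup_iQ_0^{sg}(i)$; arrows of $Q^{sg}$ are the triples $(i,\alpha,j):i\to j$ with $\alpha\in Q_1$, $i\in Q_0^{sg}(s(\alpha))$, $j\in Q_0^{sg}(t(\alpha))$; $I^{sg}$ is generated by $\sum_{j\in Q_0^{sg}(s(\beta))}\lambda_j(i,\alpha,j)(j,\beta,k)$ for paths $\alpha\beta\in I$ of length 2, $i\in Q_0^{sg}(s(\alpha))$, $k\in Q_0^{sg}(t(\beta))$, where $\lambda_j=-1$ if $j=l^-$ for some $l$ and $\lambda_j=1$ otherwise. **Generalised ribbon graph and orbifold dissection.** The ribbon graph $G_\Lambda$ of $\Lambda$ has as vertices the maximal paths of $KQ/I$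 (paths $w\notin I$ with $\alpha w,w\alpha\in I$ for all arrows $\alpha$) and the trivial paths $e_i$ for $i$ incident with only one arrow, or $i$ the target of exactly one arrow $\alpha$ and the source of exactly one arrow $\beta$ with $\alpha\beta\notin I$. Edges correspond to $i\in Q_0$: the edge $i$ joins the two vertices $w$ (counted with multiplicity) whose path passes through $i$. At $w=e_{i_1}\alpha_1e_{i_2}\cdots\alpha_{n-1}e_{i_n}$ the half-edges are ordered $i_1<\dots<i_n$, with cyclic closure the ribbon structure. $G_\Lambda$ embeds in a unique compact oriented surface $S=S_\Lambda$ with faces corresponding to boundary components, each vertex $w$ being placed on the boundary so that the boundary lies between the last and first half-edge. $G_\Lambda$ cuts $S$ into polygons with exactly one boundary edge and no boundary component in the interior, or no boundary edge and exactly one unmarked boundary component in the interior. For $i\in Sp$, the edge $i$ bounds a digon $P'$ whose other side is a boundary segment. *Local replacement*: contract that boundary segment, identifying its endpoints $p_1,p_2$, and collapse $P'$, so that the edge becomes a *special edge* from $p_1=p_2$ to a new point $o$ (an orbifold point of order two) in the interior of the other polygon containing the edge (then called a *degenerate polygon* ). Doing this for all $i\in Sp$ gives the generalised ribbon graph $G$; $M$ is its set of non-special vertices, $\mathcal O$ the set of orbifold points. *)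

(* Defs.v *)
From mathcomp Require Import all_boot all_order all_algebra.
From mathcomp Require Import boolp.
From mathcomp Require Import finmap.
From mathcomp Require Import monalg.

Set Implicit Arguments.
Unset Strict Implicit.
Unset Printing Implicit Defensive.

Import GRing.Theory.
Local Open Scope ring_scope.

Record quiver := Quiver {
  vert : finType;
  arr : finType;
  src : arr -> vert;
  tgt : arr -> vert }.

Arguments src {q}.
Arguments tgt {q}.

Section PathAlgebra.
Variable Q : quiver.

(* A path is a source together with the sequence of its arrows in the order
   in which they are traversed; (v, [::]) is the trivial path e_v. *)
Fixpoint is_qpath (v : vert Q) (w : seq (arr Q)) : bool :=
  if w is a :: w' then (src a == v) && is_qpath (tgt a) w' else true.

Definition qpath := {p : vert Q * seq (arr Q) | is_qpath p.1 p.2}.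

Definition qstart (p : qpath) : vert Q := (val p).1.
Definition qarrows (p : qpath) : seq (arr Q) := (val p).2.
Definition endpoint (v : vert Q) (w : seq (arr Q)) : vert Q :=
  last v (map tgt w).
Definition qend (p : qpath) : vert Q := endpoint (qstart p) (qarrows p).

Definition in_arrows (v : vert Q) : {set arr Q} := [set a | tgt a == v].
Definition out_arrows (v : vert Q) : {set arr Q} := [set a | src a == v].

Variable K : fieldType.

(* The underlying K-vector space of KQ, with basis the paths << p >>. *)
Definition pathalg := {malg K[qpath]}.

(* (v, w) as an element of KQ, 0 when w is not a path starting at v *)
Definition kpath (v : vert Q) (w : seq (arr Q)) : pathalg :=
  if insub (v, w) is Some p then << (p : qpath) >> else 0.

Definition karr (a : arr Q) : pathalg := kpath (src a) [:: a].

Definition kqmul (x y : pathalg) : pathalg :=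
  \sum_(p <- msupp x) \sum_(r <- msupp y)
    if qend p == qstart r
    then (x@_p * y@_r) *: kpath (qstart p) (qarrows p ++ qarrows r) else 0.

Definition ideal_gen (G : pathalg -> Prop) (x : pathalg) : Prop :=
  exists2 s : seq (pathalg * pathalg * pathalg),
    forall t, t \in s -> G t.1.2 &
    x = \sum_(t <- s) kqmul (kqmul t.1.1 t.1.2) t.2.

(* R_Q^m <= I <= R_Q^2 for some m >= 2, where R_Q is the arrow ideal, so that
   R_Q^m is spanned by the paths of length at least m *)
Definition admissible (I : pathalg -> Prop) : Prop :=
  (exists2 m : nat, (2 <= m)%N &
     forall p : qpath, (m <= size (qarrows p))%N -> I << p >>) /\
  (forall x, I x -> forall p, p \in msupp x -> (2 <= size (qarrows p))%N).

(* e_i (KQ)_n e_j *)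
Definition homog (i j : vert Q) (n : nat) (x : pathalg) : Prop :=
  forall p, p \in msupp x ->
    [/\ qstart p = i, qend p = j & size (qarrows p) = n].

(* The image of the subspace W in KQ/I has dimension d, i.e. some d elements
   of W induce a basis of it. *)
Definition image_dim (W I : pathalg -> Prop) (d : nat) : Prop :=
  exists b : 'I_d -> pathalg,
    (forall k, W (b k)) /\
    forall x, W x ->
      exists! c : {ffun 'I_d -> K}, I (x - \sum_(k < d) c k *: b k).

(* C is the q-Cartan matrix of A = KQ/I, for I generated by homogeneous
   relations: the coefficient of q^n in c_ij is dim (e_i A e_j)_n.  Such a
   polynomial matrix exists exactly when all dim e_i A e_j are finite. *)
Definition is_qCartan (I : pathalg -> Prop)
    (C : 'M[{poly int}]_#|vert Q|) : Prop :=
  forall (i j : vert Q) (n : nat),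
    exists2 d : nat, image_dim (homog i j n) I d &
      (C (enum_rank i) (enum_rank j))`_n = d%:R.

End PathAlgebra.

Arguments kpath {Q K}.
Arguments karr {Q K}.

Section Gentle.
Variables (Q : quiver) (K : fieldType) (I : pathalg Q K -> Prop).

(* The product of two arrows that do not compose is 0, hence lies in I. *)
Definition arr2_in (a b : arr Q) : Prop := I (kqmul (karr a) (karr b)).

Record gentle : Prop := Gentle {
  gentle_in : forall v : vert Q, (#|in_arrows v| <= 2)%N;
  gentle_out : forall v : vert Q, (#|out_arrows v| <= 2)%N;
  gentle_rel_next : forall a b b', tgt a = src b -> tgt a = src b' ->
    arr2_in a b -> arr2_in a b' -> b = b';
  gentle_rel_prev : forall c c' a, tgt c = src a -> tgt c' = src a ->
    arr2_in c a -> arr2_in c' a -> c = c';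
  gentle_nonrel_next : forall a b b', ~ arr2_in a b -> ~ arr2_in a b' -> b = b';
  gentle_nonrel_prev : forall c c' a,
    ~ arr2_in c a -> ~ arr2_in c' a -> c = c';
  gentle_gen : exists2 G : pathalg Q K -> Prop,
    forall x, G x ->
      exists a b : arr Q, tgt a = src b /\ x = kqmul (karr a) (karr b) &
    forall x, I x <-> ideal_gen G x;
  gentle_adm : admissible I }.

(* A special vertex carries a single special loop, so the set of special loops
   is given by the set Sp of special vertices. *)
Definition skew_gentle (Sp : {set vert Q}) : Prop :=
  gentle /\
  forall i, i \in Sp ->
    (#|out_arrows i| = 1%N \/ #|in_arrows i| = 1%N) /\
    forall a b, tgt a = i -> src b = i -> arr2_in a b.

End Gentle.

Section Admissible.
Variables (Q : quiver) (Sp : {set vert Q}).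

(* (i, false) is i^+ for i special and i otherwise; (i, true) is i^-. *)
Definition sg_vert := {x : vert Q * bool | x.2 ==> (x.1 \in Sp)}.

Definition sg_base (x : sg_vert) : vert Q := (val x).1.

Definition sg_arr :=
  {t : sg_vert * arr Q * sg_vert |
     (sg_base t.1.1 == src t.1.2) && (sg_base t.2 == tgt t.1.2)}.

Definition sg_quiver : quiver :=
  @Quiver sg_vert sg_arr (fun t => (val t).1.1) (fun t => (val t).2).

Variable K : fieldType.

(* 0 when (i, a, j) is not an arrow *)
Definition sg_karr (i : sg_vert) (a : arr Q) (j : sg_vert) :
    pathalg sg_quiver K :=
  if insub (i, a, j) is Some t then karr (t : arr sg_quiver) else 0.

Definition sg_sign (j : sg_vert) : K := if (val j).2 then -1 else 1.

Definition sg_gen (I : pathalg Q K -> Prop) (x : pathalg sg_quiver K) : Prop :=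
  exists (a b : arr Q) (i k : sg_vert),
    [/\ tgt a = src b, arr2_in I a b, sg_base i = src a, sg_base k = tgt b &
        x = \sum_(j : sg_vert | sg_base j == src b)
              sg_sign j *: kqmul (sg_karr i a j) (sg_karr j b k)].

Definition sg_ideal (I : pathalg Q K -> Prop) : pathalg sg_quiver K -> Prop :=
  ideal_gen (sg_gen I).

End Admissible.

Arguments sg_ideal {Q} Sp {K}.

(* A ribbon graph embedded in a surface with marked vertices on the boundary.
   [succ h] is the half-edge following h around its vertex, and is None when
   the boundary of the surface lies between h and its cyclic successor.
   [orbi] is the set of half-edges incident with an orbifold point. *)
Record ribbon (V : Type) := Ribbon {
  half_edge : finType;
  edge : half_edge -> V;
  other : half_edge -> half_edge;
  succ : half_edge -> option half_edge;
  orbi : {set half_edge} }.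

Section Polygons.
Variables (V : Type) (g : ribbon V).

(* A half-edge h also stands for the side of its edge seen when the edge is
   travelled from h to [other g h] with the polygon on a fixed hand.  The side
   of that polygon coming next is obtained by turning at the vertex reached;
   it is None if a boundary edge comes next. *)
Definition turn (h : half_edge g) : option (half_edge g) := succ (other h).

Definition consecutive : rel (half_edge g) :=
  [rel h h' | (turn h == Some h') || (turn h' == Some h)].

Definition polygon (h : half_edge g) : {set half_edge g} :=
  [set h' | connect consecutive h h'].

Definition polygons : {set {set half_edge g}} :=
  [set polygon h | h : half_edge g].

Definition interior (P : {set half_edge g}) : bool :=
  [forall h in P, turn h != None].

(* The two sides of a special edge lie in the same polygon, and exactly one of
   them starts at an orbifold point: the edge is counted once. *)
Definition nedges (P : {set half_edge g}) : nat := #|P :\: orbi g|.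

(* 0 for k > #|half_edge g|, so a product over k >= 1 may stop there *)
Definition ninterior (k : nat) : nat :=
  #|[set P in polygons | interior P && (nedges P == k)]|.

End Polygons.

(* Local replacement at the edges in Sp.  The edge of h bounds a digon on the
   side h when h is the first half-edge at its vertex and [other h] is the last
   one at its own vertex.  Contracting the boundary segment of the digon glues
   the two vertices, the half-edges following h now coming after [other h];
   collapsing the digon leaves [other h] as the half-edge at the glued vertex
   and h as the single half-edge at the orbifold point. *)
Section LocalReplacement.
Variables (V : finType) (g : ribbon V) (Sp : {set V}).

Definition digon (h : half_edge g) : bool :=
  [&& edge h \in Sp, [forall h', succ h' != Some h] & succ (other h) == None].

Definition local_replacement : ribbon V :=
  @Ribbon V (half_edge g) (@edge V g) (@other V g)
    (fun h => if digon h then Some h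
              else if digon (other h) then succ (other h)
              else succ h)
    (orbi g :|: [set h | digon h]).

End LocalReplacement.

Section GentleRibbon.
Variables (Q : quiver) (K : fieldType) (I : pathalg Q K -> Prop).

Definition maximal_path (v : vert Q) (w : seq (arr Q)) : Prop :=
  [/\ is_qpath v w, ~ I (kpath v w),
      forall a, I (kqmul (karr a) (kpath v w)) &
      forall a, I (kqmul (kpath v w) (karr a))].

(* The valency of v in Q is at most 1 (a loop counting for 2), or v is the
   target of exactly one arrow a and the source of exactly one arrow b, with
   ab not in I.  If v is isolated then e_v is also a maximal path; it is
   needed twice, since the edge v has two ends. *)
Definition trivial_vertex (v : vert Q) : Prop :=
  (#|in_arrows v| + #|out_arrows v| <= 1)%N \/
  exists a b, [/\ in_arrows v = [set a], out_arrows v = [set b] &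
                  ~ arr2_in I a b].

(* Candidate vertices ((v, w), t); t = true marks the additional trivial
   paths.  In a finite-dimensional gentle algebra, a path not in I has no
   repeated arrow, so its length is at most the number of arrows. *)
Definition rg_word := (vert Q * #|arr Q|.-bseq (arr Q) * bool)%type.

Definition rg_vertex (m : rg_word) : bool :=
  let: (v, w, t) := m in
  if t then nilp w && `[< trivial_vertex v >] else `[< maximal_path v w >].

(* A half-edge is an occurrence of a vertex of Q in a vertex of the ribbon
   graph; (m, k) is the occurrence after k arrows. *)
Definition rg_half :=
  {h : rg_word * 'I_#|arr Q|.+1 |
     rg_vertex h.1 && (h.2 <= size h.1.1.2)%N}.

Definition rg_edge (h : rg_half) : vert Q :=
  let: (v, w, _, k) := val h in endpoint v (take k w).

Definition rg_other (h : rg_half) : rg_half :=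
  odflt h [pick h' | (rg_edge h' == rg_edge h) && (h' != h)].

Definition rg_succ (h : rg_half) : option rg_half :=
  [pick h' : rg_half | ((val h').1 == (val h).1) &&
                       ((val h').2 == (val h).2.+1 :> nat)].

Definition gentle_ribbon : ribbon (vert Q) :=
  Ribbon rg_edge rg_other rg_succ set0.

End GentleRibbon.

Definition sg_ribbon (Q : quiver) (K : fieldType) (I : pathalg Q K -> Prop)
    (Sp : {set vert Q}) : ribbon (vert Q) :=
  local_replacement (gentle_ribbon I) Sp.

(* Main.v *)
(** Let B and R be the 0/1 matrices, indexed by the arrows of Q, of the composable
    pairs that are respectively outside and inside I.  The paths avoiding the
    relations form a basis of Lambda, so its q-Cartan matrix is
    1 + q S (1 - q B)^-1 T, where S and T record sources and targets.  At a special
    vertex the relation of I^sg merely identifies the two lifts of a product, so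
    the same formula holds for A once B is enlarged by the relations at special
    vertices and S, T are lifted to the vertices of Q^sg.  As B is nilpotent and
    det (1 + X Y) = det (1 + Y X), both determinants equal
    det (1 - q B + q T S) = det (1 + q R).

    On the other hand, turning along a polygon is a partial injection of the set of
    half-edges, and for its weighted matrix Z the determinant of 1 + Z is a product
    over the cycles, that is, over the interior polygons.  A turn either goes to an
    orbifold point or traverses an arrow, and successive arrows form relations, so
    the same identity transforms det (1 + Z) into det (1 + q R). *)

(* The determinants of A and Lambda agree by a count at each vertex. Entry (a, c) of T S is the
   number of lifts of the vertex where a and c meet. At an ordinary vertex this is 1, and the pair
   lies in exactly one of B and R. At a special vertex it is 2, and the pair, which is always a
   relation there, lies in R and also in the enlarged B. So T S - B = R in both cases.

   Nilpotency of B is read off from the Cartan matrix: a path of B adds to a coefficient of some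
   entry, in a degree that grows with its length, and the entries are polynomials. For Lambda the
   same bound makes every arrow extend to a maximal path, which the ribbon graph needs.

   A special edge has two sides in its polygon but counts once. Its side running to the orbifold
   point gets weight -1, so that the two sides together contribute 1 * (-q) to the product of the -
   x h. *)
From HB Require Import structures.
Require Import Defs.
From mathcomp Require Import all_boot all_order all_algebra perm.
From mathcomp Require Import boolp finmap monalg.

Set Implicit Arguments.
Unset Strict Implicit.
Unset Printing Implicit Defensive.

Import GRing.Theory Num.Theory.
Local Open Scope ring_scope.

(** * Determinants *)

(** Both products in [E] equal the block matrix with rows [1, -X] and [Y, 1], which therefore has
    two block triangular factorizations. *)
Lemma det_1mulmxC (R : comNzRingType) m n (X : 'M[R]_(m, n)) (Y : 'M[R]_(n, m)) :
  \det (1%:M + X *m Y) = \det (1%:M + Y *m X).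
Proof.
have E : block_mx (1%:M + X *m Y) (- X) 0 1%:M *m block_mx 1%:M 0 Y 1%:M =
         block_mx 1%:M 0 Y 1%:M *m block_mx 1%:M (- X) 0 (1%:M + Y *m X).
  rewrite !mulmx_block !mulmx1 !mul1mx !mulmx0 !mul0mx !add0r !addr0.
  by rewrite mulNmx addrK mulmxN addrC addrK.
move/(congr1 determinant): E.
by rewrite !det_mulmx !det_ublock !det_lblock !det1 !mulr1 !mul1r.
Qed.

(** If no factor [M i (s i)] of the term of [s] vanishes, then [rho j <= rho (s j)] for all [j],
    strictly where [s] moves [j]. Since [s] preserves the sum of the ranks, it moves nothing. Ties
    between ranks are allowed, so no reordering of the indices is involved. *)
Lemma det_unitriangular (R : comNzRingType) n (rho : 'I_n -> nat) (M : 'M[R]_n) :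
    (forall i, M i i = 1) ->
    (forall i j, i != j -> M i j != 0 -> (rho i < rho j)%N) ->
  \det M = 1.
Proof.
move=> M1 Mlt; rewrite /determinant (bigD1 (1%g : {perm 'I_n})) //= odd_perm1 expr0 mul1r.
rewrite big1 => [|i _]; last by rewrite perm1.
rewrite big1 ?addr0 // => s s1.
suff /existsP[i /eqP Mi0] : [exists i, M i (s i) == 0].
  by rewrite (bigD1 i) //= Mi0 mul0r mulr0.
apply: contraR s1 => /existsPn M0; apply/eqP/permP => i; rewrite perm1.
have le j : (rho j <= rho (s j))%N.
  by case: (eqVneq j (s j)) => [<- //|/Mlt/(_ (M0 _))/ltnW].
have E : (\sum_j rho j = \sum_j rho (s j))%N.
  by rewrite (reindex_inj (@perm_inj _ s)).
apply/eqP; rewrite eq_sym; apply: contraT => si.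
have := Mlt _ _ si (M0 i).
move/eqP: E; rewrite (bigD1 i) //= [X in _ == X](bigD1 i) //= => /eqP E lt.
have : (rho i + \sum_(j | j != i) rho j < rho (s i) + \sum_(j | j != i) rho (s j))%N.
  by rewrite -addSn leq_add // leq_sum.
by rewrite E ltnn.
Qed.

(* The number of points from which a given point can be reached is strictly
   increasing along an acyclic relation. *)
Lemma det_acyclic (R : comNzRingType) (T : finType) (e : rel T) (M : 'M[R]_#|T|) :
    (forall a b, e a b -> ~~ connect e b a) ->
    (forall a, M (enum_rank a) (enum_rank a) = 1) ->
    (forall a b, a != b -> M (enum_rank a) (enum_rank b) != 0 -> e a b) ->
  \det M = 1.
Proof.
move=> acy M1 M0.
apply: (@det_unitriangular _ _ (fun i => #|[pred c | connect e c (enum_val i)]|)).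
  by move=> i; rewrite -[i]enum_valK.
move=> i j ij nz; apply: proper_card; apply/properP.
have eij : e (enum_val i) (enum_val j).
  by apply: M0; rewrite ?(inj_eq enum_val_inj) // !enum_valK.
split.
  apply/subsetP=> c; rewrite !inE => ci.
  exact: connect_trans ci (connect1 eij).
by exists (enum_val j); rewrite !inE ?connect0 // acy.
Qed.

(** * Interior polygons as cycles *)

Section PolygonDeterminant.
Variables (V : Type) (g : ribbon V).
Hypothesis turn_inj :
  forall h h' z : half_edge g, turn h = Some z -> turn h' = Some z -> h = h'.

Lemma consecutive_connect_sym : connect_sym (@consecutive V g).
Proof. by apply: sym_connect_sym => h h'; apply: orbC. Qed.

Lemma polygon_eq (h h' : half_edge g) : h' \in polygon h -> polygon h = polygon h'.
Proof.
rewrite inE => hh'; apply/setP => z; rewrite !inE.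
exact: (same_connect consecutive_connect_sym).
Qed.

Lemma polygon_refl (h : half_edge g) : h \in polygon h.
Proof. by rewrite inE connect0. Qed.

Lemma polygonsP P h : P \in polygons g -> h \in P -> P = polygon h.
Proof. by case/imsetP => h0 _ -> /polygon_eq. Qed.

Lemma polygons_turn P h z :
  P \in polygons g -> turn h = Some z -> (h \in P) = (z \in P).
Proof.
case/imsetP => h0 _ -> hz; rewrite !inE.
by apply: (same_connect_r consecutive_connect_sym); apply: connect1; apply/orP; left; rewrite hz.
Qed.

Variables (R : comNzRingType) (x : half_edge g -> R).

Definition hvec (h : half_edge g) : 'rV[R]_#|half_edge g| := delta_mx 0 (enum_rank h).

(** The matrix [1 + Z] of the partial map [turn], with the rows in [H] reduced to rows of the
    identity. Cutting a row opens the cycle through it, so cycles can be split off the determinant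
    one at a time. *)
Definition cut_mx (H : {set half_edge g}) : 'M[R]_#|half_edge g| :=
  \matrix_(i < #|half_edge g|) let h := enum_val i in
    hvec h + (if h \in H then 0 else
              if turn h is Some h' then x h *: hvec h' else 0).

Lemma hvec_cut_mx H h :
  hvec h *m cut_mx H = hvec h + (if h \in H then 0 else
              if turn h is Some h' then x h *: hvec h' else 0).
Proof. by rewrite -rowE rowK enum_rankK. Qed.

Lemma cut_mxE H h h' :
  cut_mx H (enum_rank h) (enum_rank h') =
    (h == h')%:R + (if (h \notin H) && (turn h == Some h') then x h else 0).
Proof.
have -> : cut_mx H (enum_rank h) (enum_rank h') = (row (enum_rank h) (cut_mx H)) 0 (enum_rank h').
  by rewrite [RHS]mxE.
rewrite rowE hvec_cut_mx mxE {1}/hvec mxE eqxx /= (inj_eq enum_rank_inj) eq_sym.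
congr (_ + _); case: (h \in H); first by rewrite mxE.
case: (turn h) => [z|] /=; last by rewrite mxE.
rewrite !mxE eqxx (inj_eq enum_rank_inj) -[Some z == _]/(z == h') eq_sym.
by case: (z == h'); rewrite ?mulr1 ?mulr0.
Qed.

Section Cut.
Variables (P H : {set half_edge g}) (h : half_edge g).
Hypotheses (polyP : P \in polygons g) (intP : interior P) (hP : h \in P).
Hypothesis PH : [disjoint P & H].

(** Extending the turn on [P] by the identity gives a total injection, to which [orbit] and [order]
    apply. As [P] is interior, the default inside [odflt] is never reached. *)
Let nxt (t : half_edge g) := if t \in P then odflt t (turn t) else t.

Let turn_nxt t : t \in P -> turn t = Some (nxt t).
Proof.
move=> tP; rewrite /nxt tP; move/forallP/(_ t): intP; rewrite tP /=.
by case: (turn t).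
Qed.

Let nxtP t : (nxt t \in P) = (t \in P).
Proof.
case tP : (t \in P); last by rewrite /nxt tP.
by rewrite -(polygons_turn polyP (turn_nxt tP)).
Qed.

Let nxt_inj : injective nxt.
Proof.
move=> t t' E; have := nxtP t; rewrite E nxtP.
case tP : (t \in P) => tP'; last by move: E; rewrite /nxt tP tP'.
by apply: (turn_inj (turn_nxt tP)); rewrite E; apply: turn_nxt.
Qed.

(** A polygon is a class for steps taken in both directions. Reachability under an injection of a
    finite type is symmetric, so backward steps do not leave the orbit either. *)
Let orbitP : orbit nxt h =i P.
Proof.
move=> z; rewrite -fconnect_orbit; apply/idP/idP.
  by move=> /iter_findex <-; elim: (findex _ _ _) => //= n; rewrite nxtP.
rewrite (polygonsP polyP hP) inE => /connectP[s + ->].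
have sym := fconnect_sym nxt_inj.
elim: s (h) hP => [|a s IH] t tP /=; first by rewrite connect0.
case/andP => E ps.
have [tP' ta] : (a \in P) /\ fconnect nxt t a.
  case/orP: E => /eqP E.
    split; first by rewrite -(polygons_turn polyP E).
    by move: E; rewrite (turn_nxt tP) => -[<-]; apply: fconnect1.
  have aP : a \in P by rewrite (polygons_turn polyP E).
  split=> //; rewrite sym.
  by move: E; rewrite (turn_nxt aP) => -[<-]; apply: fconnect1.
exact: connect_trans ta (IH _ tP' ps).
Qed.

(* Following the cycle P from the successor h1 of h, with the coefficients c i,
   gives a row vector u such that u * M(h |: H) is the basis vector of h1, so
   that M(H) = (1 + x h * e_h * u) * M(h |: H). *)
Lemma det_cut_mx :
  \det (cut_mx H) = (1 - \prod_(t in P) (- x t)) * \det (cut_mx (h |: H)).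
Proof.
(* The cycle has [k.+1] half-edges; counted from [h1], the cut one [h] comes last, at index [k]. *)
pose h1 := nxt h; pose k := (order nxt h).-1.
have ordh : order nxt h = k.+1 by rewrite prednK ?order_gt0.
have itP i : iter i nxt h1 \in P by elim: i => [|i IH] /=; rewrite nxtP.
have itk : iter k nxt h1 = h by rewrite /h1 -iterSr -ordh iter_order.
pose c i := \prod_(l < i) - x (iter l nxt h1).
pose u := \sum_(0 <= i < k.+1) c i *: hvec (iter i nxt h1).
have ith i : (i < k)%N -> iter i nxt h1 != h.
  move=> ik; rewrite /h1 -iterSr; apply/eqP => E.
  have := orbit_uniq nxt h; rewrite /orbit ordh => /= /andP[/negP[]].
  apply/trajectP; exists i; first by [].
  by rewrite -iterSr E.
(* For [i < k] the row at index [i] contributes [c i] times its own basis vector minus [c i.+1]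
   times the next one; the cut row at index [k] contributes only its own. The sum telescopes to the
   first term. *)
have uM : u *m cut_mx (h |: H) = hvec h1.
  rewrite /u mulmx_suml.
  have Hh i : iter i nxt h1 \notin H by rewrite (disjointFr PH).
  have -> : \sum_(0 <= i < k.+1) (c i *: hvec (iter i nxt h1)) *m cut_mx (h |: H) =
     \sum_(0 <= i < k) (c i *: hvec (iter i nxt h1) - c i.+1 *: hvec (iter i.+1 nxt h1))
       + c k *: hvec (iter k nxt h1).
    rewrite big_nat_recr //=; congr (_ + _).
      rewrite !big_mkord; apply: eq_bigr => i _; rewrite -scalemxAl hvec_cut_mx.
      rewrite in_setU1 (negbTE (ith _ _)) //= (negbTE (Hh _)) (turn_nxt (itP i)).
      rewrite scalerDr scalerA; congr (_ + _).
      by rewrite /c [in RHS]big_ord_recr /= mulrN scaleNr opprK.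
    by rewrite -scalemxAl hvec_cut_mx itk setU11 addr0.
  rewrite (telescope_sumr_eq (fun i => - (c i *: hvec (iter i nxt h1)))) //.
    by rewrite opprK addrC addrA addrN add0r /c big_ord0 scale1r.
  by move=> i _; rewrite opprK addrC.
have E : cut_mx H = (1%:M + (x h *: (hvec h)^T) *m u) *m cut_mx (h |: H).
  rewrite mulmxDl mul1mx -mulmxA uM -scalemxAl /hvec trmx_delta mul_delta_mx.
  apply/matrixP => i j; rewrite -[i]enum_valK -[j]enum_valK.
  set a := enum_val i; set b := enum_val j.
  rewrite [RHS]mxE !cut_mxE -addrA; congr (_ + _).
  rewrite !mxE !(inj_eq enum_rank_inj) in_setU1 negb_or.
  case: (eqVneq a h) => [->|_] /=; last by rewrite mulr0 addr0.
  rewrite add0r (disjointFr PH hP) (turn_nxt hP) /= eq_sym.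
  by rewrite -[Some _ == _]/(b == h1); case: eqVneq; rewrite ?mulr1 ?mulr0.
rewrite E det_mulmx; congr (_ * _).
(* The rank one factor becomes the scalar [1 + x h * c k]. Here [c k] is the product of the [- x t]
   over the rest of the cycle, and [x h] supplies the missing factor up to sign. *)
rewrite det_1mulmxC det_mx11 mxE mxE eqxx -scalemxAr mxE.
have -> : (u *m (hvec h)^T) 0 0 = c k.
  rewrite /u mulmx_suml summxE big_nat_recr //= big1_seq ?add0r => [|i].
    rewrite -scalemxAl itk /hvec trmx_delta mul_delta_mx !mxE eqxx mulr1 //.
  rewrite mem_index_iota => /= ik.
  rewrite -scalemxAl /hvec trmx_delta mul_delta_mx_0 ?scaler0 ?mxE //.
  by rewrite (inj_eq enum_rank_inj) ith.
rewrite -(eq_bigl _ _ orbitP) -big_uniq ?orbit_uniq //= /orbit ordh /= big_cons.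
rewrite mulNr opprK; congr (_ + _ * _).
rewrite /c -(big_mkord predT (fun l => - x (iter l nxt h1))).
have -> : traject nxt (nxt h) k = map (fun l => iter l nxt h1) (index_iota 0 k).
  rewrite /index_iota subn0; apply: (@eq_from_nth _ h).
    by rewrite size_traject size_map size_iota.
  move=> i; rewrite size_traject => ik.
  by rewrite (set_nth_default (nxt h)) ?size_traject // nth_traject //
     (nth_map 0%N) ?size_iota // nth_iota.
by rewrite big_map.
Qed.

End Cut.

(** * Acyclicity once every interior polygon is cut *)

Definition cut_rel (H : {set half_edge g}) : rel (half_edge g) :=
  [rel a b | (a \notin H) && (turn a == Some b)].

Let cut_relE H a b : cut_rel H a b = (a \notin H) && (turn a == Some b).
Proof. by []. Qed.

Let on_cycle H (c : half_edge g) := [exists d, cut_rel H c d && connect (cut_rel H) d c].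

(** Since [turn] is a partial function, a cycle through [c] leaves along [z]; since it is injective,
    a cycle through [z] arrives from [c]. *)
Let on_cycle_turn H c z : turn c = Some z -> on_cycle H c = on_cycle H z.
Proof.
move=> cz; apply/existsP/existsP => -[d /andP[/= /andP[nH /eqP cd]]].
  move: cd; rewrite cz => -[<-] {d} /connectP[[|y s] /= ps E].
    by subst z; exists c; rewrite cut_relE nH cz eqxx connect0.
  case/andP: ps => zy ys; exists y; rewrite zy; apply: (@connect_trans _ _ c).
    by apply/connectP; exists s.
  by apply: connect1; rewrite cut_relE nH cz eqxx.
case/connectP => s; elim/last_ind: s => [|s y _] /=.
  move=> _ E; subst d; have E := turn_inj cz cd; subst c.
  by exists z; rewrite cut_relE nH cd eqxx connect0.
rewrite rcons_path last_rcons => /andP[ps /andP[nlH /eqP ly]] E; subst y.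
have lc := turn_inj ly cz.
exists z; rewrite cut_relE -lc nlH ly eqxx /= lc.
apply: (@connect_trans _ _ d); first by apply: connect1; rewrite cut_relE nH cd eqxx.
by rewrite -lc; apply/connectP; exists s.
Qed.

(** By [on_cycle_turn] a cycle spreads over its whole polygon. Then every half-edge of the polygon
    has a turn and avoids [H], so the polygon is interior and uncut. *)
Let cut_acyclic (H : {set half_edge g}) :
    (forall P, P \in polygons g -> interior P -> exists2 h, h \in P & h \in H) ->
  forall a b, cut_rel H a b -> ~~ connect (cut_rel H) b a.
Proof.
move=> Hcut a b ab; apply/negP => ba.
have cyc c : c \in polygon a -> on_cycle H c.
  rewrite inE => /connectP[s + ->].
  have : on_cycle H a by apply/existsP; exists b; rewrite ab.
  elim: s (a) => //= d s IH t ct /andP[E ps]; apply: IH ps.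
  by case/orP: E => /eqP/(on_cycle_turn H) E; rewrite ?E // -E.
have aP : polygon a \in polygons g by apply: imset_f.
have [|h hP hH] := Hcut _ aP.
  apply/forallP => c; apply/implyP => /cyc /existsP[d /andP[/andP[_ /eqP->]]] //.
by case/existsP: (cyc _ hP) => d; rewrite cut_relE hH.
Qed.

(* With one row erased in every interior polygon no cycle is left. *)
Lemma det_turn_mx :
  \det (cut_mx set0) =
    \prod_(P in polygons g | interior P) (1 - \prod_(h in P) (- x h)).
Proof.
pose ps := enum [pred P | (P \in polygons g) && interior P].
(* There may be no half-edge to serve as a default, hence the option. *)
have [rep repP] : exists rep : {set half_edge g} -> option (half_edge g),
    forall P, P \in ps -> exists2 h, rep P = Some h & h \in P.
  exists (fun P : {set half_edge g} => [pick h in P]) => P.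
  rewrite mem_enum => /andP[/imsetP[h _ ->] _].
  case: pickP => [h' h'P|/(_ h)]; first by exists h'.
  by rewrite /= polygon_refl.
pose H s := [set h | Some h \in map rep s].
have step s : uniq s -> {subset s <= ps} ->
    \det (cut_mx set0) = (\prod_(P <- s) (1 - \prod_(h in P) (- x h))) * \det (cut_mx (H s)).
  elim: s => [|P s IH] /=.
    by rewrite big_nil mul1r => _ _; congr (\det (cut_mx _)); apply/setP => h; rewrite !inE.
  move=> /andP[Ps us] sub; rewrite big_cons IH //; last first.
    by move=> P' P's; apply: sub; rewrite in_cons P's orbT.
  rewrite [LHS]mulrC [in RHS]mulrAC; congr (_ * _).
  have Pps : P \in ps by apply: sub; rewrite mem_head.
  have [h rh hP] := repP _ Pps.
  move: (Pps); rewrite mem_enum => /andP[Ppol Pint].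
  have -> : H (P :: s) = h |: H s.
    by apply/setP => z; rewrite !inE rh.
  apply: det_cut_mx => //; rewrite disjoint_subset; apply/subsetP => z zP.
  rewrite !inE; apply: contra Ps => /mapP[P' P's E].
  have P'ps : P' \in ps by apply: sub; rewrite in_cons P's orbT.
  have [z' rz' zP'] := repP _ P'ps; move: E; rewrite rz' => -[E]; subst z'.
  move: (P'ps); rewrite mem_enum => /andP[P'pol _].
  by rewrite (polygonsP Ppol zP) -(polygonsP P'pol zP').
rewrite (step ps) ?enum_uniq // big_enum /=.
rewrite (_ : \det _ = 1) ?mulr1 //.
apply: (@det_acyclic _ _ (cut_rel (H ps))).
- apply: cut_acyclic => P Ppol Pint.
  have Pps : P \in ps by rewrite mem_enum inE Ppol.
  have [h rh hP] := repP _ Pps; exists h => //.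
  by rewrite inE -rh map_f.
- move=> a; rewrite cut_mxE eqxx; case: ifP => [/andP[aH /eqP ta]|_]; last by rewrite addr0.
  have /negP[] : ~~ connect (cut_rel (H ps)) a a; last exact: connect0.
  apply: cut_acyclic; last by rewrite cut_relE aH ta eqxx.
  move=> P Ppol Pint.
  have Pps : P \in ps by rewrite mem_enum inE Ppol.
  have [h rh hP] := repP _ Pps; exists h => //.
  by rewrite inE -rh map_f.
move=> a b ab; rewrite cut_mxE (negbTE ab) add0r /cut_rel /=.
by case: ifP => //; rewrite eqxx.
Qed.

End PolygonDeterminant.

(** * Path algebras *)

Section LinearExtension.
Variables (L : choiceType) (K : fieldType) (V : lmodType K) (F : L -> V).

Definition malg_lift (x : {malg K[L]}) : V := \sum_(p <- msupp x) x@_p *: F p.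

Lemma malg_liftw (d : {fset L}) (x : {malg K[L]}) : (msupp x `<=` d)%fset ->
  malg_lift x = \sum_(p <- d) x@_p *: F p.
Proof.
move=> le; rewrite /malg_lift (big_fset_incl _ le) // => p _ /mcoeff_outdom ->.
by rewrite scale0r.
Qed.

Lemma malg_lift_linear : linear malg_lift.
Proof.
move=> c x y; pose d := (msupp x `|` msupp y)%fset.
have lex : (msupp x `<=` d)%fset by apply: fsubsetUl.
have ley : (msupp y `<=` d)%fset by apply: fsubsetUr.
have le : (msupp (c *: x + y) `<=` d)%fset.
  apply: fsubset_trans (msuppD_le _ _) _; apply: fsetSU; exact: msuppZ_le.
rewrite (malg_liftw lex) (malg_liftw ley) (malg_liftw le) scaler_sumr -big_split /=.
by apply: eq_bigr => p _; rewrite mcoeffD mcoeffZ scalerDl scalerA.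
Qed.

HB.instance Definition _ :=
  GRing.isLinear.Build K {malg K[L]} V *:%R malg_lift malg_lift_linear.

Lemma malg_liftU p : malg_lift << p >> = F p.
Proof. by rewrite /malg_lift msuppU oner_eq0 big_seq_fset1 mcoeffUU scale1r. Qed.

End LinearExtension.

Lemma malg_lift_id (L : choiceType) (K : fieldType) (x : {malg K[L]}) :
  malg_lift (fun p => << p >>) x = x.
Proof.
rewrite [RHS]monalgE; apply: eq_bigr => p _; apply/malgP => k.
by rewrite mcoeffZ !mcoeffU mulr_natr.
Qed.

Lemma linear_sumZ (R : pzRingType) (U V : lmodType R) (f : U -> V)
    (I : Type) (r : seq I) (c : I -> R) (F : I -> U) :
  linear f -> f (\sum_(i <- r) c i *: F i) = \sum_(i <- r) c i *: f (F i).
Proof.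
move=> lf; have f0 : f 0 = 0.
  by have := lf (-1) 0 0; rewrite scaler0 addr0 scaleN1r addNr.
elim: r => [|i r IH]; first by rewrite !big_nil.
by rewrite !big_cons lf IH.
Qed.

Section Kqmul.
Variables (Q : quiver) (K : fieldType).
Implicit Types (v : vert Q) (w : seq (arr Q)) (x y z : pathalg Q K).

Lemma endpoint_cat v w w' : endpoint v (w ++ w') = endpoint (endpoint v w) w'.
Proof. by rewrite /endpoint map_cat last_cat. Qed.

Lemma is_qpath_cat v w w' :
  is_qpath v (w ++ w') = is_qpath v w && is_qpath (endpoint v w) w'.
Proof. by elim: w v => //= a w IH v; rewrite IH andbA. Qed.

Lemma kpathE (p : qpath Q) : << p >> = kpath (qstart p) (qarrows p) :> pathalg Q K.
Proof.
rewrite /kpath /qstart /qarrows; case: insubP => [u _ E|].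
  by congr << _ >>; apply: val_inj; rewrite E; case: (val p).
by case: p => -[v w] /= vw; rewrite vw.
Qed.

Lemma kpath_qpath v w : is_qpath v w ->
  exists p : qpath Q, [/\ qstart p = v, qarrows p = w & kpath v w = << p >> :> pathalg Q K].
Proof. by move=> vw; exists (exist _ (v, w) vw); rewrite kpathE. Qed.

Let pmul (p r : qpath Q) : pathalg Q K :=
  if qend p == qstart r then kpath (qstart p) (qarrows p ++ qarrows r) else 0.

Lemma kqmulE x y : kqmul x y = malg_lift (fun p => malg_lift (pmul p) y) x.
Proof.
apply: eq_bigr => p _; rewrite scaler_sumr; apply: eq_bigr => r _.
by rewrite /pmul scalerA; case: ifP => //; rewrite scaler0.
Qed.

Lemma kqmul_linear_l y : linear (fun x => kqmul x y).
Proof. by move=> c x x'; rewrite !kqmulE linearP. Qed.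

Lemma kqmul_linear_r x : linear (kqmul x).
Proof.
move=> c y y'; rewrite !kqmulE /malg_lift scaler_sumr -big_split /=.
apply: eq_bigr => p _; rewrite -![\sum_(_ <- msupp _) _]/(malg_lift _ _) linearP.
by rewrite scalerDr !scalerA mulrC.
Qed.

Lemma kqmulZl c x y : kqmul (c *: x) y = c *: kqmul x y.
Proof. by rewrite !kqmulE linearZ. Qed.

Lemma kqmul0l x : kqmul 0 x = 0.
Proof. by rewrite kqmulE linear0. Qed.

Lemma kqmulBl x x' y : kqmul (x - x') y = kqmul x y - kqmul x' y.
Proof. by rewrite !kqmulE linearB. Qed.

Lemma kqmulBr x y y' : kqmul x (y - y') = kqmul x y - kqmul x y'.
Proof. by rewrite addrC -scaleN1r kqmul_linear_r scaleN1r addrC. Qed.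

Lemma kqmulZr c x y : kqmul x (c *: y) = c *: kqmul x y.
Proof.
have x0 : kqmul x 0 = 0 by rewrite -(subrr 0) kqmulBr !subrr.
by rewrite -[c *: y]addr0 kqmul_linear_r x0 addr0.
Qed.

Lemma kqmul_kpath v w v' w' : is_qpath v w -> is_qpath v' w' ->
  kqmul (kpath v w) (kpath v' w') =
    if endpoint v w == v' then kpath v (w ++ w') else 0 :> pathalg Q K.
Proof.
move=> /kpath_qpath[p [pv pw ->]] /kpath_qpath[r [rv rw ->]].
by rewrite kqmulE !malg_liftU /pmul /qend pv pw rv rw.
Qed.

(** This is what makes monomial ideals tractable: a two-sided multiple of a path by basis paths is
    zero or one path containing it, so coefficients can be tested path by path. *)
Lemma kqmul_qpath (s r : qpath Q) v w : is_qpath v w ->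
  let x : pathalg Q K := kqmul (kqmul << s >> (kpath v w)) << r >> in
  x = 0 \/ exists2 t : qpath Q, qarrows t = qarrows s ++ w ++ qarrows r & x = << t >>.
Proof.
move=> vw /=.
have sP : is_qpath (qstart s) (qarrows s) := valP s.
have rP : is_qpath (qstart r) (qarrows r) := valP r.
rewrite [<< s >>]kpathE [<< r >>]kpathE kqmul_kpath //.
case: eqP => sv; last by left; rewrite kqmul0l.
rewrite kqmul_kpath ?is_qpath_cat ?sP ?sv //.
case: eqP => wr; last by left.
have [|t [_ tw ->]] := @kpath_qpath (qstart s) ((qarrows s ++ w) ++ qarrows r).
  by rewrite is_qpath_cat wr rP is_qpath_cat sv sP vw.
by right; exists t; rewrite // catA.
Qed.

Lemma kqmul_karr a b :
  kqmul (karr a) (karr b) =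
    if tgt a == src b then kpath (src a) [:: a; b] else 0 :> pathalg Q K.
Proof. by rewrite kqmul_kpath //= eqxx. Qed.

Definition subspace (S : pathalg Q K -> Prop) : Prop :=
  S 0 /\ forall c x y, S x -> S y -> S (c *: x + y).

Lemma subspace_sum S (I : eqType) (r : seq I) (c : I -> K) (F : I -> pathalg Q K) :
  subspace S -> {in r, forall i, S (F i)} -> S (\sum_(i <- r) c i *: F i).
Proof.
move=> [S0 SD]; elim: r => [|i r IH] SF; rewrite ?big_nil ?big_cons //.
apply: SD; first exact/SF/mem_head.
by apply: IH => k kr; apply: SF; rewrite in_cons kr orbT.
Qed.

Lemma subspaceB S x y : subspace S -> S x -> S y -> S (x - y).
Proof. by move=> [_ SD] Sx Sy; rewrite addrC -scaleN1r; apply: SD. Qed.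

Lemma subspace_kqmul S x y z : subspace S ->
    (forall p r : qpath Q, S (kqmul (kqmul << p >> x) << r >>)) ->
  S (kqmul (kqmul y x) z).
Proof.
move=> subS Sx; rewrite -[y]malg_lift_id -[z]malg_lift_id /malg_lift.
rewrite (linear_sumZ _ _ _ (kqmul_linear_r _)); apply: subspace_sum => // r _.
rewrite (linear_sumZ _ _ _ (kqmul_linear_l _)) (linear_sumZ _ _ _ (kqmul_linear_l _)).
by apply: subspace_sum => // p _; apply: Sx.
Qed.

Lemma mcoeff_subspace (p : qpath Q) : subspace (fun x => x@_p = 0).
Proof.
split=> [|c x y]; first by rewrite mcoeff0.
by rewrite mcoeffD mcoeffZ => -> ->; rewrite mulr0 addr0.
Qed.

Section IdealGen.
Variable G : pathalg Q K -> Prop.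

Lemma ideal_gen_subspace : subspace (ideal_gen G).
Proof.
split; first by exists [::]; rewrite ?big_nil.
move=> c x y [s sG ->] [s' s'G ->].
exists ([seq (c *: t.1.1, t.1.2, t.2) | t <- s] ++ s').
  move=> t; rewrite mem_cat => /orP[/mapP[u us ->]|]; last exact: s'G.
  exact: (sG u us).
rewrite big_cat big_map scaler_sumr; congr (_ + _); apply: eq_bigr => t _ /=.
by rewrite !kqmulZl.
Qed.

Lemma ideal_genM x y z : G y -> ideal_gen G (kqmul (kqmul x y) z).
Proof.
move=> Gy; exists [:: (x, y, z)]; last by rewrite big_seq1.
by move=> t; rewrite inE => /eqP->.
Qed.

Lemma ideal_gen_sub S : subspace S ->
    (forall x y z, G y -> S (kqmul (kqmul x y) z)) ->
  forall x, ideal_gen G x -> S x.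
Proof.
move=> [S0 SD] SG x [s sG ->]; elim: s sG => [|t s IH] sG; rewrite ?big_nil //.
rewrite big_cons.
have Gt : G t.1.2 by apply: sG; exact: mem_head.
have {}IH := IH (fun u us => sG u (@mem_behead _ (t :: s) u us)).
by have := SD 1 _ _ (SG t.1.1 _ t.2 Gt) IH; rewrite scale1r.
Qed.

End IdealGen.

Lemma homog_subspace i j n : subspace (@homog Q K i j n).
Proof.
split=> [p|c x y Hx Hy p]; first by rewrite msupp0.
move/(fsubsetP (msuppD_le _ _)); rewrite in_fsetU => /orP[|/Hy //].
by move/(fsubsetP (msuppZ_le _ _)) => /Hx.
Qed.

(* The hypotheses say that f maps the image of W in KQ/I isomorphically
   onto K^N. *)
Lemma image_dim_eq (W I : pathalg Q K -> Prop) d N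
    (f : {linear pathalg Q K -> 'rV[K]_N}) :
    subspace W ->
    (forall x, I x -> f x = 0) -> (forall x, W x -> f x = 0 -> I x) ->
    (forall u, exists2 x, W x & f x = u) ->
  image_dim W I d -> d = N.
Proof.
move=> [W0 WD] If fI fsurj [b [Wb bP]].
pose M : 'M[K]_(d, N) := \matrix_k f (b k).
have cM (c : {ffun 'I_d -> K}) : (\row_k c k) *m M = f (\sum_(k < d) c k *: b k).
  rewrite linear_sum mulmx_sum_row; apply: eq_bigr => k _.
  by rewrite rowK mxE linearZ.
have : row_full M.
  rewrite -sub1mx; apply/row_subP => i.
  have [x Wx fx] := fsurj (row i 1%:M).
  have [c [/If + _]] := bP _ Wx.
  rewrite linearB /= -cM => /subr0_eq; rewrite fx => ->; exact: submxMl.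
(* A row of the kernel of [M] gives a combination of the [b k] that lies in [I]. It then provides
   coordinates of the vector 0, as do zero coefficients, and coordinates are unique. *)
have : row_free M.
  rewrite -kermx_eq0; apply/eqP/row_matrixP => i; rewrite row0.
  set u := row i _.
  have uM : u *m M = 0 by rewrite -row_mul mulmx_ker row0.
  have [c [_ cu]] := bP _ W0.
  pose cc := [ffun k => u 0 k].
  have E : u = \row_k cc k by apply/rowP => k; rewrite [RHS]mxE ffunE.
  have c1 : c = cc.
    apply: cu; rewrite sub0r; apply: fI.
      rewrite -sub0r; apply: subspaceB; [by [] | by [] |].
      by apply: subspace_sum => // k _.
    by rewrite linearN /= -cM -E uM oppr0.
  have c2 : c = [ffun=> 0].
    apply: cu; rewrite big1 ?subr0 => [|k _]; last by rewrite ffunE scale0r.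
    by apply: fI => //; rewrite linear0.
  by rewrite E; apply/rowP => k; rewrite !mxE -c1 c2 ffunE.
by rewrite /row_free /row_full => /eqP-> /eqP.
Qed.

End Kqmul.

(** * Bases of paths *)

(* Q' is the pullback of Q along pv: for the gentle algebra pv is the identity,
   for the skew-gentle one it forgets the signs.  B holds for the pairs of arrows
   whose product is nonzero, and G identifies all the lifts of a path of Q with
   given ends. *)
Section Pullback.
Variables (Q Q' : quiver) (pv : vert Q' -> vert Q) (pa : arr Q' -> arr Q).
Hypothesis pv_src : forall a, pv (src a) = src (pa a).
Hypothesis pv_tgt : forall a, pv (tgt a) = tgt (pa a).
Hypothesis pv_surj : forall v, exists i, pv i = v.
Hypothesis arrow_lift : forall i a j, pv i = src a -> pv j = tgt a ->
  exists a', [/\ src a' = i, tgt a' = j & pa a' = a].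
Hypothesis arrow_inj : forall a b, src a = src b -> tgt a = tgt b ->
  pa a = pa b -> a = b.

Variable B : rel (arr Q).
Hypothesis B_comp : forall a b, B a b -> tgt a = src b.

Variables (K : fieldType) (G : pathalg Q' K -> Prop).
Hypothesis G_cases : forall x, G x ->
  (exists v w, [/\ is_qpath v w, ~~ sorted B (map pa w) & x = kpath v w]) \/
  (exists v w w', [/\ is_qpath v w, is_qpath v w', endpoint v w = endpoint v w',
      map pa w = map pa w' & x = kpath v w - kpath v w']).
Hypothesis G_bad : forall a b, tgt a = src b -> ~~ B (pa a) (pa b) ->
  G (kpath (src a) [:: a; b]).
Hypothesis G_diff : forall a b a' b', tgt a = src b -> tgt a' = src b' ->
  src a = src a' -> tgt b = tgt b' -> pa a = pa a' -> pa b = pa b' -> a <> a' ->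
  let x := kpath (src a) [:: a; b] - kpath (src a) [:: a'; b'] in G x \/ G (- x).

Notation J := (ideal_gen G).

Lemma is_qpath_map v w : is_qpath v w -> is_qpath (pv v) (map pa w).
Proof.
elim: w v => //= a w IH v /andP[/eqP<- aw].
by rewrite pv_src eqxx -pv_tgt IH.
Qed.

Lemma endpoint_map v w : pv (endpoint v w) = endpoint (pv v) (map pa w).
Proof.
elim: w v => //= a w IH v.
by rewrite -[LHS]/(pv (endpoint (tgt a) w)) IH pv_tgt.
Qed.

(** Inner vertices are lifted at will and only the two ends are prescribed. A path without arrows
    has a single end, whence the last hypothesis. *)
Lemma qpath_lift i j w : is_qpath (pv i) w -> endpoint (pv i) w = pv j ->
    (w = [::] -> i = j) ->
  exists w', [/\ is_qpath i w', endpoint i w' = j & map pa w' = w].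
Proof.
elim: w i => [|a [|b w] IH] i /=.
- by move=> _ _ /(_ erefl) ->; exists [::].
- rewrite andbT => /eqP sa ta _.
  have [a' [sa' ta' pa']] := arrow_lift (esym sa) (esym ta).
  by exists [:: a']; rewrite /= sa' pa' eqxx.
move=> /andP[/eqP sa aw] ej _; have [i' i'a] := pv_surj (tgt a).
have [a' [sa' ta' pa']] := arrow_lift (esym sa) i'a.
have [] // := IH i'; rewrite ?i'a //.
move=> w' [pw' ew' mw']; exists (a' :: w').
by rewrite -[endpoint i _]/(endpoint (tgt a') w') /= sa' eqxx ta' pa' mw' pw' ew'.
Qed.

Lemma kqmul3 v u w t : is_qpath v (u ++ w ++ t) ->
  kqmul (kqmul (kpath v u) (kpath (endpoint v u) w)) (kpath (endpoint v (u ++ w)) t)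
    = kpath v (u ++ w ++ t) :> pathalg Q' K.
Proof.
rewrite !is_qpath_cat => /and3P[vu uw wt].
rewrite kqmul_kpath // eqxx kqmul_kpath ?is_qpath_cat ?vu //.
  by rewrite eqxx catA.
by rewrite endpoint_cat.
Qed.

Lemma bad_path v w : is_qpath v w -> ~~ sorted B (map pa w) -> J (kpath v w).
Proof.
move=> vw nB; have [u [a [b [t [E nab]]]]] : exists u a b t,
    w = u ++ [:: a; b] ++ t /\ ~~ B (pa a) (pa b).
  elim: w nB {vw} => [|a [|b w] IH] //=; rewrite negb_and => /orP[ab|].
    by exists [::], a, b, w; rewrite ab.
  by move=> /IH[u [c [d [t [-> ncd]]]]]; exists (a :: u), c, d, t.
have ab : tgt a = src b.
  by move: vw; rewrite E is_qpath_cat /= => /and4P[_ _ /eqP].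
have ua : endpoint v u = src a.
  by move: vw; rewrite E is_qpath_cat /= => /and4P[_ /eqP].
rewrite E -kqmul3 -?E // ua; apply: ideal_genM.
exact: G_bad.
Qed.

(** Where the paths first differ, let [b''] be the lift of [b] that starts where [a'] ends and ends
    where [b] ends. Exchanging [a, b] for [a', b''] changes the path by a multiple of a generator,
    up to sign, and the new path shares one more arrow with the second one. If only one arrow is
    left, the common ends force [a = a']. *)
Lemma diff_path v u w w' : is_qpath v (u ++ w) -> is_qpath v (u ++ w') ->
    endpoint v (u ++ w) = endpoint v (u ++ w') -> map pa w = map pa w' ->
  J (kpath v (u ++ w) - kpath v (u ++ w')).
Proof.
have [J0 JD] := ideal_gen_subspace G.
move E : (size w) => n; elim: n u w w' E => [|n IH] u w w' sw.
  by case: w sw => // _; case: w' => // *; rewrite subrr.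
case: w sw => // a w [sw]; case: w' => //= a' w'.
move=> pw pw' ew [eqa eqw].
have [aa'|/eqP aa'] := eqVneq a a'.
  subst a'; have := IH (rcons u a) w w'; rewrite !cat_rcons; exact.
case: w sw pw ew eqw => [|b w] sw pw ew eqw.
  case: w' eqw pw' ew => // _ pw' ew; case: aa'; apply: arrow_inj => //.
    move: pw pw'; rewrite !is_qpath_cat /=.
    by do 2 case/and3P=> _ /eqP -> _.
  by move: ew; rewrite !endpoint_cat.
case: w' eqw pw' ew => // b' w' [eqb eqw] pw' ew.
move: (pw) (pw'); rewrite !is_qpath_cat /= => /and4P[vu /eqP sa /eqP ab bw].
move=> /and4P[_ /eqP sa' /eqP ab' bw'].
have [b'' [sb'' tb'' pb'']] : exists b'', [/\ src b'' = tgt a', tgt b'' = tgt b & pa b'' = pa b].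
  apply: arrow_lift; last exact: pv_tgt.
  by rewrite -ab' pv_src eqb.
have -> : kpath v (u ++ [:: a, b & w]) - kpath v (u ++ [:: a', b' & w']) =
   1 *: (kpath v (u ++ [:: a, b & w]) - kpath v (u ++ [:: a', b'' & w]))
   + (kpath v (u ++ [:: a', b'' & w]) - kpath v (u ++ [:: a', b' & w'])) :> pathalg Q' K.
  by rewrite scale1r addrA subrK.
have pw'' : is_qpath v (u ++ [:: a', b'' & w]).
  by rewrite is_qpath_cat vu /= sa' sb'' tb'' bw !eqxx.
have ew'' : endpoint v (u ++ [:: a, b & w]) = endpoint v (u ++ [:: a', b'' & w]).
  by rewrite !endpoint_cat /endpoint /= tb''.
apply: (JD).
  have -> : kpath v (u ++ [:: a, b & w]) - kpath v (u ++ [:: a', b'' & w]) =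
     kqmul (kqmul (kpath v u) (kpath (src a) [:: a; b] - kpath (src a) [:: a'; b'']))
       (kpath (tgt b) w) :> pathalg Q' K.
    rewrite kqmulBr kqmulBl; congr (_ - _).
      by have := @kqmul3 v u [:: a; b] w pw; rewrite endpoint_cat -sa => <-.
    have := @kqmul3 v u [:: a'; b''] w pw''.
    by rewrite endpoint_cat -sa /endpoint /= tb'' => <-.
  have saa : src a = src a' by rewrite sa sa'.
  have [] := G_diff (esym ab) (esym sb'') saa (esym tb'') eqa (esym pb'') aa' => Gx.
    exact: ideal_genM.
  rewrite -[X in kqmul (kqmul _ X) _]opprK -[- - _]scaleN1r kqmulZr kqmulZl -[_ *: _]addr0.
  by apply: JD => //; apply: ideal_genM.
have := IH (rcons u a') (b'' :: w) (b' :: w'); rewrite !cat_rcons; apply=> //.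
  by rewrite -ew''.
by rewrite /= pb'' eqb eqw.
Qed.

(** The words that index a basis of the paths from [i] to [j] modulo the ideal. The last condition
    concerns the trivial path, since [pv i = pv j] does not imply [i = j]. *)
Definition gword (i j : vert Q') (w : seq (arr Q)) : bool :=
  [&& sorted B w, is_qpath (pv i) w, endpoint (pv i) w == pv j &
      (w == [::]) ==> (i == j)].

(** * Dimension of the graded pieces *)

Section Dimension.
Variables (i j : vert Q') (n : nat).

Let T : finType := {t : n.-tuple (arr Q) | gword i j t}.

Let word (t : {t : n.-tuple (arr Q) | gword i j t}) : seq (arr Q) := sval t.

Let wordP t : gword i j (word t). Proof. exact: (valP t). Qed.

Let word_inj : injective word.
Proof. by move=> t t' E; do 2 apply: val_inj. Qed.

Let lifts (w : seq (arr Q)) (p : qpath Q') :=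
  [&& qstart p == i, qend p == j & map pa (qarrows p) == w].

(** Coordinates on the quotient: a path from [i] to [j] goes to the basis vector of its word, if
    this is a [gword], and any other path to 0. Like the ideal, this forgets which lift was
    chosen. *)
Let projU (p : qpath Q') : 'rV[K]_#|T| :=
  \row_(k < #|T|) (lifts (word (enum_val k)) p)%:R.

Let proj : {linear pathalg Q' K -> 'rV[K]_#|T|} := malg_lift projU.

Let proj_kpath v w k : is_qpath v w ->
  proj (kpath v w) 0 k =
    [&& v == i, endpoint v w == j & map pa w == word (enum_val k)]%:R.
Proof.
by move=> /(kpath_qpath K)[p [pv' pw ->]]; rewrite [proj _]malg_liftU mxE /lifts /qend pv' pw.
Qed.

Let proj_ideal x : J x -> proj x = 0.
Proof.
have subS : subspace (fun x => proj x = 0).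
  by split=> [|c y z]; rewrite ?linear0 // linearP => -> ->; rewrite scaler0 addr0.
apply: (ideal_gen_sub subS) => y {}x z Gx; apply: (subspace_kqmul _ _ subS) => p r.
rewrite !kpathE; move: (valP p) (valP r); rewrite -!/(qstart _) -!/(qarrows _).
move: (qstart p) (qarrows p) (qstart r) (qarrows r) => v u e t vu et.
have kq3 w : is_qpath (endpoint v u) w ->
    kqmul (kqmul (kpath v u) (kpath (endpoint v u) w)) (kpath e t) =
      if endpoint (endpoint v u) w == e then kpath v (u ++ w ++ t) else 0
    :> pathalg Q' K.
  move=> uw; rewrite kqmul_kpath // eqxx kqmul_kpath ?is_qpath_cat ?vu //.
  by rewrite endpoint_cat catA.
(* A multiple of a bad path is still bad, so its word is no [gword]. A multiple of a difference is
   zero or a difference of two lifts of one word, which have the same coordinates. *)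
case: (G_cases Gx) => [[a [w [aw bad ->]]]|[a [w [w' [aw aw' ew mw ->]]]]].
  have [ua|ua] := eqVneq a (endpoint v u); last first.
    by rewrite (kqmul_kpath _ vu aw) eq_sym (negbTE ua) kqmul0l linear0.
  rewrite ua kq3 -?ua //; case: eqP => [we|_]; last exact: linear0.
  apply/rowP => k; rewrite proj_kpath ?is_qpath_cat ?vu -?ua ?aw ?we //.
  rewrite [RHS]mxE; case: and3P => // -[_ _ /eqP E].
  have := wordP (enum_val k); rewrite -E /= => /and4P[srt _ _ _].
  case/negP: bad; move: srt; rewrite !map_cat.
  by case/cat_sorted2 => _ /cat_sorted2[].
rewrite kqmulBr kqmulBl linearB.
have [ua|ua] := eqVneq a (endpoint v u); last first.
  rewrite (kqmul_kpath _ vu aw) (kqmul_kpath _ vu aw') eq_sym (negbTE ua).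
  by rewrite kqmul0l subrr.
subst a; apply/eqP; rewrite subr_eq0; apply/eqP.
apply: (etrans (congr1 proj (kq3 _ aw))).
apply: (etrans _ (esym (congr1 proj (kq3 _ aw')))).
rewrite -ew; case: eqP => [we|//].
have pw : is_qpath v (u ++ w ++ t) by rewrite !is_qpath_cat vu aw we et.
have pw' : is_qpath v (u ++ w' ++ t) by rewrite !is_qpath_cat vu aw' -ew we et.
apply/rowP => k; rewrite !proj_kpath //.
by rewrite !endpoint_cat ew !map_cat mw.
Qed.

Lemma image_dim_gword d : image_dim (homog i j n) J d -> d = #|T|.
Proof.
have [lift liftP] : exists lift : T -> qpath Q', forall t, lifts (word t) (lift t).
  suff /choice[lift liftP] : forall t, exists p, lifts (word t) p by exists lift.
  move=> t; have /and4P[_ tp te t0] := wordP t.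
  have [|w [iw ew mw]] := qpath_lift tp (eqP te).
    by move=> E; move: t0; rewrite E => /eqP.
  exists (exist _ (i, w) iw); rewrite /lifts /qstart /qend /qarrows /=.
  by rewrite eqxx ew mw !eqxx.
apply: (@image_dim_eq _ _ _ _ _ _ proj).
- exact: homog_subspace.
- exact: proj_ideal.
- move=> x hx px0.
  (* [can p] is the chosen lift of the word of [p], or 0 if that word does not occur in [T]. Each
     [p - can p] lies in the ideal by [bad_path] or [diff_path]; the remaining sum of the [can p]
     collects the coordinates of [x], which vanish. *)
  pose can p : pathalg Q' K := \sum_(t : T) (lifts (word t) p)%:R *: << lift t >>.
  have subJ := ideal_gen_subspace G.
  have -> : x = 1 *: (\sum_(p <- msupp x) x@_p *: (<< p >> - can p)) +
       \sum_(p <- msupp x) x@_p *: can p.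
    rewrite scale1r -big_split -[LHS]malg_lift_id; apply: eq_bigr => p _ /=.
    by rewrite -scalerDr subrK.
  case: (subJ) => J0 JD; apply: JD; last first.
    rewrite /can; under eq_bigr do rewrite scaler_sumr.
    rewrite exchange_big /= big1 // => t _.
    under eq_bigr do rewrite scalerA; rewrite -scaler_suml.
    move/rowP/(_ (enum_rank t)): px0; rewrite [proj _]/(malg_lift projU _) /malg_lift summxE mxE.
    under eq_bigr do rewrite !mxE enum_rankK.
    by move=> ->; rewrite scale0r.
  apply: subspace_sum => // p /hx[pi pj pn].
  rewrite /can; have [srt|nsrt] := boolP (sorted B (map pa (qarrows p))); last first.
    rewrite big1 => [|t _].
      by rewrite subr0 kpathE; exact: (bad_path (valP p) nsrt).
    rewrite /lifts; case: and3P => [[_ _ /eqP E]|]; last by rewrite scale0r.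
    by case/negP: nsrt; rewrite E; case/and4P: (wordP t).
  have sz : size (map pa (qarrows p)) == n by rewrite size_map pn.
  have gw : gword i j (Tuple sz).
    rewrite /gword srt /= -pi is_qpath_map ?(valP p) // -endpoint_map.
    rewrite -/(qend p) pj eqxx /=; apply/implyP => /eqP.
    move: pj; rewrite /qend; case: (qarrows p) => //=.
    by rewrite pi => <-.
  pose t0 : T := exist (fun t : n.-tuple (arr Q) => gword i j t) (Tuple sz) gw.
  have t0p : lifts (word t0) p by rewrite /lifts pi pj !eqxx.
  rewrite (bigD1 t0) //= big1 => [|t tp].
    rewrite addr0 (_ : _%:R = 1) ?t0p // scale1r.
    rewrite [<< p >>]kpathE.
    rewrite [<< lift _ >>]kpathE.
    have /and3P[/eqP li /eqP lj /eqP lw] := liftP t0.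
    rewrite li pi; apply: (@diff_path i [::]) => /=.
    - by rewrite -pi; exact: (valP p).
    - by rewrite -li; exact: (valP (lift _)).
    - by rewrite -{1}pi -[LHS]/(qend p) -[in RHS]li -[RHS]/(qend (lift _)) pj lj.
    by rewrite lw.
  rewrite /lifts; case: and3P => [[_ _ /eqP E]|]; last by rewrite scale0r.
  by case/eqP: tp; do 2 apply: val_inj; rewrite /= E.
- move=> u; exists (\sum_(t : T) u 0 (enum_rank t) *: << lift t >>).
    apply: subspace_sum; first exact: homog_subspace.
    move=> t _ p; rewrite msuppU oner_eq0 in_fset1 => /eqP ->.
    have /and3P[/eqP li /eqP lj /eqP lw] := liftP t.
    by split=> //; rewrite -(size_map pa) lw size_tuple.
  rewrite linear_sum; apply/rowP => k; rewrite summxE (bigD1 (enum_val k)) //=.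
  rewrite big1 ?addr0 => [|t tk].
    by rewrite linearZ /= [proj _]malg_liftU !mxE liftP mulr1 enum_valK.
  rewrite linearZ /= [proj _]malg_liftU !mxE.
  rewrite /lifts; case: and3P => [[_ _ /eqP E]|]; last by rewrite mulr0.
  have /and3P[_ _ /eqP E'] := liftP t.
  by case/eqP: tk; apply: word_inj; rewrite -E -E'.
Qed.

End Dimension.

End Pullback.

(** * The q-Cartan matrix *)

(** Running round a cycle repeatedly would give arbitrarily long paths. *)
Lemma bounded_acyclic (T : finType) (e : rel T) N :
    (forall a t, path e a t -> (size t < N)%N) ->
  forall a b, e a b -> ~~ connect e b a.
Proof.
move=> eN a b ab; apply/negP => /connectP[s bs lbs].
have [t [/eN tN [_]]] : exists t, path e a t /\ last a t = a /\ (N <= size t)%N.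
  elim: N {eN} => [|n [t [pt [lt st]]]]; first by exists [::].
  exists ((b :: s) ++ t); rewrite cat_path last_cat /= ab bs -lbs pt lt; do 2 split=> //.
  by rewrite /= size_cat ltnS (leq_trans st) ?leq_addl.
by rewrite leqNgt tN.
Qed.

(** * Counting words by matrix powers *)

Section TupleSums.
Variables (V : nmodType) (T : finType).

Lemma sum_tuple0 (F : 0.-tuple T -> V) : \sum_t F t = F [tuple].
Proof. by rewrite (bigD1 [tuple]) //= big1 ?addr0 // => t /eqP[]; apply: tuple0. Qed.

Lemma sum_tupleS n (F : n.+1.-tuple T -> V) :
  \sum_t F t = \sum_a \sum_(t : n.-tuple T) F (cons_tuple a t).
Proof.
rewrite pair_big /= (reindex (fun p : T * n.-tuple T => cons_tuple p.1 p.2)) //=.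
exists (fun t => (thead t, behead_tuple t)) => [[a t]|t] _ /=.
  by rewrite theadE; congr (_, _); apply: val_inj.
by apply: val_inj; rewrite [t in RHS]tuple_eta.
Qed.

End TupleSums.

Section RelationPower.
Variables (R : pzRingType) (T : finType) (e : rel T).

Definition rel_mx : 'M[R]_#|T| := \matrix_(i, j) (e (enum_val i) (enum_val j))%:R.

Lemma rel_mxX n a b : (rel_mx ^+ n) (enum_rank a) (enum_rank b) =
  (\sum_(t : n.-tuple T) (path e a t && (last a t == b)))%:R.
Proof.
elim: n a => [|n IH] a.
  by rewrite sum_tuple0 /= expr0 mxE (inj_eq enum_rank_inj).
rewrite sum_tupleS exprS -mulmxE mxE natr_sum (reindex enum_rank) /=; last first.
  by apply: onW_bij; apply: enum_rank_bij.
apply: eq_bigr => c _; rewrite IH mxE !enum_rankK /=.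
by case: (e a c); rewrite ?mul1r // mul0r big1.
Qed.

Lemma rel_mx_nilp N : (forall a t, path e a t -> (size t < N)%N) ->
  rel_mx ^+ N = 0.
Proof.
move=> eN; apply/matrixP => i j.
rewrite -[i]enum_valK -[j]enum_valK rel_mxX mxE big1 // => t _.
by case: andP => // -[/eN]; rewrite size_tuple ltnn.
Qed.

End RelationPower.

Lemma exprZmx (R : comPzRingType) n (x : R) (A : 'M[R]_n) k :
  (x *: A) ^+ k = x ^+ k *: A ^+ k.
Proof.
elim: k => [|k IH]; first by rewrite !expr0 scale1r.
by rewrite !exprS IH -!mulmxE -scalemxAl -scalemxAr scalerA.
Qed.

Section QCartan.
Variables (Q Q' : quiver) (pv : vert Q' -> vert Q) (pa : arr Q' -> arr Q).
Hypothesis pv_src : forall a, pv (src a) = src (pa a).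
Hypothesis pv_tgt : forall a, pv (tgt a) = tgt (pa a).
Hypothesis pv_surj : forall v, exists i, pv i = v.
Hypothesis arrow_lift : forall i a j, pv i = src a -> pv j = tgt a ->
  exists a', [/\ src a' = i, tgt a' = j & pa a' = a].
Hypothesis arrow_inj : forall a b, src a = src b -> tgt a = tgt b ->
  pa a = pa b -> a = b.

Variable B : rel (arr Q).
Hypothesis B_comp : forall a b, B a b -> tgt a = src b.

Variables (K : fieldType) (G : pathalg Q' K -> Prop).
Hypothesis G_cases : forall x, G x ->
  (exists v w, [/\ is_qpath v w, ~~ sorted B (map pa w) & x = kpath v w]) \/
  (exists v w w', [/\ is_qpath v w, is_qpath v w', endpoint v w = endpoint v w',
      map pa w = map pa w' & x = kpath v w - kpath v w']).
Hypothesis G_bad : forall a b, tgt a = src b -> ~~ B (pa a) (pa b) ->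
  G (kpath (src a) [:: a; b]).
Hypothesis G_diff : forall a b a' b', tgt a = src b -> tgt a' = src b' ->
  src a = src a' -> tgt b = tgt b' -> pa a = pa a' -> pa b = pa b' -> a <> a' ->
  let x := kpath (src a) [:: a; b] - kpath (src a) [:: a'; b'] in G x \/ G (- x).

Variable C : 'M[{poly int}]_#|vert Q'|.
Hypothesis qC : is_qCartan (ideal_gen G) C.

Let gcount n i j := (\sum_(t : n.-tuple (arr Q)) gword pv B i j t)%N.

Let qC_gcount i j n : (C (enum_rank i) (enum_rank j))`_n = (gcount n i j)%:R.
Proof.
have [d + ->] := qC i j n.
move/(image_dim_gword pv_src pv_tgt pv_surj arrow_lift arrow_inj G_cases G_bad G_diff) => ->.
by rewrite card_sig -sum1_card big_mkcond.
Qed.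

Lemma path_qpath a t : path B a t -> is_qpath (tgt a) t.
Proof. by elim: t a => //= b t IH a /andP[/B_comp -> /IH]; rewrite eqxx. Qed.

Let gword_cons i j a t :
  gword pv B i j (a :: t) =
    [&& pv i == src a, path B a t & tgt (last a t) == pv j].
Proof.
rewrite /gword /= andbT eq_sym /endpoint /= last_map.
by case pt: (path B a t); rewrite ?andbF // path_qpath // andbT.
Qed.

(** The word [a :: t] makes the coefficient of degree [(size t).+1] positive in some entry of [C],
    so the degrees of the entries bound its length. *)
Lemma qCartan_bound : exists N, forall a t, path B a t -> (size t < N)%N.
Proof.
exists (\max_i \max_j size (C i j)) => a t pt.
have [i ia] := pv_surj (src a); have [j jt] := pv_surj (tgt (last a t)).
apply: leq_trans (leq_bigmax (enum_rank i)).
apply: leq_trans (leq_bigmax (enum_rank j)).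
rewrite ltnNge; apply/negP => sz.
have := qC_gcount i j (size t).+1; rewrite nth_default ?(leqW sz) // => /eqP.
rewrite eq_sym pnatr_eq0 /gcount (bigD1 (in_tuple (a :: t))) //= gword_cons.
by rewrite ia pt jt !eqxx.
Qed.

Let S : 'M[{poly int}]_(#|vert Q'|, #|arr Q|) :=
  \matrix_(i, a) (pv (enum_val i) == src (enum_val a))%:R.
Let T : 'M[{poly int}]_(#|arr Q|, #|vert Q'|) :=
  \matrix_(a, j) (tgt (enum_val a) == pv (enum_val j))%:R.
Let b := rel_mx {poly int} B.

Let gcount_mx n i j :
  (S *m (b ^+ n *m T)) (enum_rank i) (enum_rank j) = (gcount n.+1 i j)%:R.
Proof.
rewrite mxE (reindex enum_rank) /=; last by apply: onW_bij; apply: enum_rank_bij.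
rewrite /gcount sum_tupleS natr_sum; apply: eq_bigr => a _.
rewrite !mxE !enum_rankK.
rewrite (reindex enum_rank) /=; last by apply: onW_bij; apply: enum_rank_bij.
under eq_bigr do rewrite rel_mxX natr_sum mulr_suml.
rewrite exchange_big /= mulr_sumr natr_sum; apply: eq_bigr => t _.
rewrite gword_cons (bigD1 (last a t)) //= big1 => [|c /negbTE lc].
  rewrite addr0 !mxE !enum_rankK eqxx andbT.
  by case: (pv i == _) (path _ _ _) (tgt _ == _) => [] [] []; rewrite ?mulr1 ?mulr0 ?mul0r.
by rewrite eq_sym lc andbF mul0r.
Qed.

(** The words of length [k.+1] are counted by [S b^k T], the trivial paths by the identity, and no
    word of length above [N] exists: the geometric series of the overview, truncated at [N]. *)
Let qC_mx N : (forall a t, path B a t -> (size t < N)%N) ->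
  C = 1%:M + S *m ((\sum_(k < N) ('X *: b) ^+ k) *m ('X *: T)).
Proof.
move=> BN; apply/matrixP => i j; rewrite -[i]enum_valK -[j]enum_valK.
set u := enum_val i; set v := enum_val j.
have E : (S *m ((\sum_(k < N) ('X *: b) ^+ k) *m ('X *: T))) (enum_rank u) (enum_rank v) =
  \sum_(k < N) 'X^(k.+1) * (gcount k.+1 u v)%:R.
  rewrite mulmx_suml mulmx_sumr summxE; apply: eq_bigr => k _.
  rewrite exprZmx -scalemxAl -!scalemxAr scalerA -exprSr mxE.
  by rewrite gcount_mx.
rewrite mxE E mxE (inj_eq enum_rank_inj); apply/polyP => n.
rewrite qC_gcount coefD coef_sum.
have cn m l : (m%:R : {poly int})`_l = if l == 0%N then m%:R else 0.
  by rewrite -(rmorph_nat polyC) coefC.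
under eq_bigr do rewrite coefXnM cn.
rewrite cn; case: n => [|n] /=.
  rewrite big1 // addr0 /gcount sum_tuple0 /gword /=.
  by case: (eqVneq u v) => [->|_]; rewrite ?andbF // andbT eqxx.
rewrite add0r; have [nN|Nn] := ltnP n N.
  rewrite (bigD1 (Ordinal nN)) //= ltnn subnn big1 ?addr0 // => k kn.
  have {}kn : (k != n :> nat) by [].
  by rewrite ltnS subSS subn_eq0; case: ltngtP kn.
rewrite big1 => [|k _]; last first.
  have lt : (k < n)%N by apply: leq_trans Nn.
  by rewrite ltnS ltnNge (ltnW lt) /= subSS subn_eq0 leqNgt lt.
rewrite /gcount sum_tupleS big1 // => a _; rewrite big1 // => t _.
rewrite gword_cons; case pt: (path B a t); last by rewrite andbF.
by have := BN _ _ pt; rewrite size_tuple ltnNge Nn.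
Qed.

(* W inverts 1 - q b, whose determinant is 1; hence C = 1 + q S W T has the same
   determinant as (1 - q b) (1 + q W T S) = 1 + q (T S - b). *)
Lemma det_qCartan (r : rel (arr Q)) :
    (forall a c, r a c + B a c = (tgt a == src c) * #|[pred x | pv x == src c]|)%N ->
  \det C = \det (1%:M + 'X *: rel_mx {poly int} r).
Proof.
move=> rB; have [N BN] := qCartan_bound.
rewrite (qC_mx BN) det_1mulmxC; set W := \sum_(k < N) _.
have bW : (1%:M - 'X *: b) *m W = 1%:M.
  have := subrX1 ('X *: b) N.
  rewrite exprZmx rel_mx_nilp // scaler0 sub0r -/W => E.
  by apply/eqP; rewrite -opprB mulNmx eqr_oppLR; apply/eqP; exact: (esym E).
have d1 : \det (1%:M - 'X *: b) = 1.
  apply: (@det_acyclic _ _ B); first exact: bounded_acyclic BN.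
    move=> a; rewrite !mxE !enum_rankK eqxx.
    case Ba: (B a a); last by rewrite mulr0 subr0.
    by have := bounded_acyclic BN Ba; rewrite connect0.
  move=> a c ac; rewrite !mxE !enum_rankK (inj_eq enum_rank_inj) (negbTE ac) sub0r.
  by case: (B a c) => //; rewrite mulr0 oppr0 eqxx.
rewrite -[LHS]mul1r -[X in X * _]d1 -det_mulmx mulmxDr mulmx1 !mulmxA bW mul1mx.
congr (\det _); rewrite -addrA; congr (_ + _).
(* Entry (a, c) of [T *m S] counts the vertices of [Q'] above the vertex where [a] and [c] meet,
   which is the right-hand side of [rB]. *)
have -> : rel_mx _ r = T *m S - b.
  apply/eqP; rewrite -subr_eq opprK; apply/eqP/matrixP => i j.
  rewrite !mxE -natrD rB natrM -sum1_card natr_sum big_mkcond mulr_sumr.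
  rewrite [RHS](reindex enum_rank) /=; last by apply: onW_bij; apply: enum_rank_bij.
  apply: eq_bigr => x _; rewrite !mxE !enum_rankK inE.
  by case: (eqVneq (pv x) _) => [->|_]; rewrite ?mulr0.
by rewrite scalerBr addrC scalemxAl.
Qed.

End QCartan.

(** * Gentle and skew-gentle algebras *)

Section Relations.
Variables (Q : quiver) (K : fieldType) (I : pathalg Q K -> Prop).

Definition relation : rel (arr Q) :=
  [rel a b | (tgt a == src b) && `[< arr2_in I a b >]].

(** For [Sp = set0] these are the nonzero products in Lambda. Pairs meeting at a special vertex are
    added because their product, though zero in Lambda, survives in A: the relation only identifies
    its two lifts. *)
Definition nonrelation (Sp : {set vert Q}) : rel (arr Q) :=
  [rel a b | (tgt a == src b) && ((src b \in Sp) || ~~ `[< arr2_in I a b >])].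

Lemma relationP a b : reflect (tgt a = src b /\ arr2_in I a b) (relation a b).
Proof.
by apply: (iffP andP) => [[/eqP ab /asboolP Iab]|[/eqP ab /asboolP Iab]].
Qed.

Lemma nonrelation0 a b : nonrelation set0 a b = (tgt a == src b) && ~~ relation a b.
Proof. by rewrite /nonrelation /relation /= inE; case: eqP. Qed.

Lemma nonrelation_comp Sp a b : nonrelation Sp a b -> tgt a = src b.
Proof. by case/andP => /eqP. Qed.

Hypothesis gI : gentle I.

(** [gentle] provides some generating set of paths of length 2. By length, such a path can occur in
    a two-sided multiple of a generator only if it is that generator, so the generating set consists
    of all the relations. *)
Let G_exists : exists2 G : pathalg Q K -> Prop,
    forall x, G x <-> exists2 ab : arr Q * arr Q,
        relation ab.1 ab.2 & x = kpath (src ab.1) [:: ab.1; ab.2] &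
    I = ideal_gen G.
Proof.
case: gI => _ _ _ _ _ _ [G G2 IG] _.
have IE : I = ideal_gen G by apply/funext => x; apply/propext; apply: IG.
exists G => // x; split=> [Gx|[[a b] /= /relationP[ab Iab] ->]].
  have [a [b [ab E]]] := G2 _ Gx; exists (a, b) => /=; last first.
    by rewrite E kqmul_karr ab eqxx.
  apply/relationP; split=> //; rewrite /arr2_in -E IE.
  have xE : x = kpath (src a) ([::] ++ [:: a; b] ++ [::]).
    by rewrite E kqmul_karr ab eqxx.
  rewrite xE -kqmul3 /=; last by rewrite ab !eqxx.
  by apply: ideal_genM; rewrite /endpoint /= -[kpath _ [:: a; b]]xE.
move: Iab; rewrite /arr2_in kqmul_karr ab eqxx IE => Iab.
apply: contrapT => nG.
have abP : is_qpath (src a) [:: a; b] by rewrite /= ab !eqxx.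
have [p [pa pab E]] := kpath_qpath K abP.
suff : (kpath (src a) [:: a; b] : pathalg Q K)@_p = 0.
  by rewrite E mcoeffUU; apply/eqP; apply: oner_neq0.
apply: (ideal_gen_sub (mcoeff_subspace K p) _ Iab) => y g z Gg.
apply: (subspace_kqmul _ _ (mcoeff_subspace K p)) => s r.
have [c [d [cd gE]]] := G2 _ Gg; rewrite kqmul_karr cd eqxx in gE; rewrite gE.
have cdP : is_qpath (src c) [:: c; d] by rewrite /= cd !eqxx.
have [->|[t tw ->]] := kqmul_qpath K s r cdP; first exact: mcoeff0.
rewrite mcoeffU; case: eqP => // tp; case: nG.
rewrite tp pab in tw; have := congr1 size tw.
rewrite !size_cat /= addnCA add2n => /esym/eqP; rewrite !eqSS addn_eq0.
case/andP => /nilP s0 /nilP r0.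
by move: tw; rewrite s0 r0 /= => -[-> ->]; rewrite -gE.
Qed.

(** As the ideal is monomial, every path in the support of one of its elements contains a
    relation. *)
Lemma gentle_path v w : is_qpath v w ->
  I (kpath v w) <-> ~~ sorted (nonrelation set0) w.
Proof.
have [G GP IE] := G_exists; move=> vw.
have Gbad x : G x -> exists a b, relation a b /\ x = kpath (src a) [:: a; b].
  by case/GP => -[a b] /= ? ?; exists a, b.
rewrite IE; split=> [Iw|bad]; last first.
  apply: (@bad_path Q Q id (nonrelation set0) K G _ v w vw); last by rewrite map_id.
  move=> a b ab; rewrite nonrelation0 ab eqxx negbK => rab.
  by apply/GP; exists (a, b).
have [p [pv pw E]] := kpath_qpath K vw.
apply/negP => srt; suff : (kpath v w : pathalg Q K)@_p = 0.
  by rewrite E mcoeffUU; apply/eqP; apply: oner_neq0.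
apply: (ideal_gen_sub (mcoeff_subspace K p) _ Iw) => y g z /Gbad[c [d [cd ->]]].
apply: (subspace_kqmul _ _ (mcoeff_subspace K p)) => s r.
have cdP : is_qpath (src c) [:: c; d] by rewrite /=; case/relationP: cd => -> _; rewrite !eqxx.
have [->|[t tw ->]] := kqmul_qpath K s r cdP; first exact: mcoeff0.
rewrite mcoeffU; case: eqP => // tp.
move: srt; rewrite -pw -tp tw => /cat_sorted2[_ /cat_sorted2[+ _]].
by rewrite /sorted /path nonrelation0 cd andbF.
Qed.

Lemma det_gentle C : is_qCartan I C ->
  \det C = \det (1%:M + 'X *: rel_mx {poly int} relation) /\
  exists N, forall a t, path (nonrelation set0) a t -> (size t < N)%N.
Proof.
have [G GP IE] := G_exists; rewrite {1}IE => qC.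
have surj (v : vert Q) : exists i, id i = v by exists v.
have lift i a j : i = src a -> j = tgt a ->
    exists a' : arr Q, [/\ src a' = i, tgt a' = j & id a' = a].
  by move=> -> ->; exists a.
have Gcases x : G x ->
    (exists v w, [/\ is_qpath v w, ~~ sorted (nonrelation set0) (map id w) & x = kpath v w]) \/
    (exists v w w', [/\ is_qpath v w, is_qpath v w', endpoint v w = endpoint v w',
      map id w = map id w' & x = kpath v w - kpath v w']).
  move=> /GP[[a b] /= rab ->]; left; exists (src a), [:: a; b].
  have /relationP[ab _] := rab.
  by split; rewrite /= ?andbT ?nonrelation0 ?rab ?andbF ?ab ?eqxx.
have Gbad a b : tgt a = src b -> ~~ nonrelation set0 (id a) (id b) ->
    G (kpath (src a) [:: a; b]).
  move=> ab; rewrite nonrelation0 ab eqxx negbK => rab.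
  by apply/GP; exists (a, b).
have Gdiff (a b a' b' : arr Q) : tgt a = src b -> tgt a' = src b' ->
    src a = src a' -> tgt b = tgt b' -> id a = id a' -> id b = id b' -> a <> a' ->
    let x := kpath (src a) [:: a; b] - kpath (src a) [:: a'; b'] in G x \/ G (- x).
  by move=> ? ? ? ? /= -> _ [].
have inj (a b : arr Q) : src a = src b -> tgt a = tgt b -> id a = id b -> a = b by [].
split; last first.
  exact: (@qCartan_bound Q Q id id (fun=> erefl) (fun=> erefl) surj lift inj
    (nonrelation set0) (@nonrelation_comp _) K G Gcases Gbad Gdiff C qC).
apply: (@det_qCartan Q Q id id (fun=> erefl) (fun=> erefl) surj lift inj
    (nonrelation set0) (@nonrelation_comp _) K G Gcases Gbad Gdiff C qC).
move=> a c; rewrite nonrelation0 card1 muln1.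
by rewrite /relation /=; case: eqP => //= _; case: `[< _ >].
Qed.

End Relations.

Section SkewGentle.
Variables (Q : quiver) (K : fieldType) (I : pathalg Q K -> Prop) (Sp : {set vert Q}).
Hypothesis sI : skew_gentle I Sp.

Let sg_plus (v : vert Q) : sg_vert Sp := exist (fun x => x.2 ==> (x.1 \in Sp)) (v, false) isT.
(** At a vertex that is not special [insubd] falls back to [sg_plus v], so facts about [sg_minus]
    assume [v \in Sp]. *)
Let sg_minus (v : vert Q) : sg_vert Sp := insubd (sg_plus v) (v, true).

Let sg_minus_val v : v \in Sp -> val (sg_minus v) = (v, true).
Proof. by move=> vS; rewrite insubdK. Qed.

Let sg_sign_plus v : sg_sign K (sg_plus v) = 1.
Proof. by []. Qed.

Let sg_sign_minus v : v \in Sp -> sg_sign K (sg_minus v) = -1.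
Proof. by move=> vS; rewrite /sg_sign sg_minus_val. Qed.

Lemma sum_sg_base (V : nmodType) (F : sg_vert Sp -> V) v :
  \sum_(j | sg_base j == v) F j = F (sg_plus v) + (if v \in Sp then F (sg_minus v) else 0).
Proof.
rewrite (bigD1 (sg_plus v)) /=; last by rewrite /sg_base.
congr (_ + _); case: ifP => vS.
  rewrite (bigD1 (sg_minus v)) /= ?big1 ?addr0 // => [j|].
    case/andP => /andP[/eqP jv jp] /eqP[]; apply: val_inj; rewrite sg_minus_val // -jv.
    move: jp; case: j jv => -[u []] //= p uv.
    by case/eqP; apply: val_inj; rewrite /= -uv.
  by rewrite /sg_base -val_eqE !sg_minus_val // eqxx -pair_eqE /= andbF.
apply: big1 => j /andP[/eqP jv /eqP[]]; apply: val_inj.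
case: j jv => -[u []] //= p; rewrite /sg_base /= => uv; last by rewrite uv.
by rewrite -uv p in vS.
Qed.

Let tri (i : sg_vert Sp) (a : arr Q) (j : sg_vert Sp) :
    sg_base i = src a -> sg_base j = tgt a ->
  exists t : arr (sg_quiver Sp), val t = (i, a, j).
Proof.
move=> ia ja; have H : (sg_base i == src a) && (sg_base j == tgt a) by rewrite ia ja !eqxx.
by exists (exist _ (i, a, j) H).
Qed.

Let sg_karrE (t : arr (sg_quiver Sp)) i a j : val t = (i, a, j) ->
  sg_karr K i a j = karr t.
Proof. by move=> E; rewrite /sg_karr -E valK. Qed.

Let sg_path2 (i k j : sg_vert Sp) a b :
    sg_base i = src a -> sg_base j = tgt a -> sg_base j = src b -> sg_base k = tgt b ->
  exists s t : arr (sg_quiver Sp), [/\ val s = (i, a, j), val t = (j, b, k) &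
    kqmul (sg_karr K i a j) (sg_karr K j b k) = @kpath (sg_quiver Sp) K i [:: s; t]].
Proof.
move=> ia ja jb kb; have [s sE] := tri ia ja; have [t tE] := tri jb kb.
exists s, t; split=> //; rewrite (sg_karrE sE) (sg_karrE tE) kqmul_karr /=.
by rewrite sE tE /= eqxx.
Qed.

Let sg_cases (j : sg_vert Sp) : j = sg_plus (sg_base j) \/
  (sg_base j \in Sp /\ j = sg_minus (sg_base j)).
Proof.
case E : (val j) (valP j) => [v []] /= vS; rewrite /sg_base E /=; [right|left].
  by split=> //; apply: val_inj; rewrite sg_minus_val.
by apply: val_inj.
Qed.

Let kpath2 (s t : arr (sg_quiver Sp)) : tgt s = src t ->
  kpath (src s) [:: s; t] =
    kqmul (sg_karr K (src s) (val s).1.2 (tgt s)) (sg_karr K (tgt s) (val t).1.2 (tgt t)).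
Proof.
have E (r : arr (sg_quiver Sp)) : val r = (src r, (val r).1.2, tgt r).
  by rewrite /=; case: (val r) => [[? ?] ?].
move=> st; rewrite (sg_karrE (E s)) st (sg_karrE (E t)) kqmul_karr.
by rewrite ifT //; apply/eqP.
Qed.

Lemma card_sg_base v : #|[pred x : sg_vert Sp | sg_base x == v]| = (1 + (v \in Sp))%N.
Proof. by rewrite -sum1_card sum_sg_base; case: (v \in Sp). Qed.

Lemma det_skew_gentle C : is_qCartan (sg_ideal Sp I) C ->
  \det C = \det (1%:M + 'X *: rel_mx {poly int} (relation I)).
Proof.
move=> qC.
have base_src (t : arr (sg_quiver Sp)) : sg_base (src t) = src (val t).1.2.
  by case/andP: (valP t) => /eqP.
have base_tgt (t : arr (sg_quiver Sp)) : sg_base (tgt t) = tgt (val t).1.2.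
  by case/andP: (valP t) => _ /eqP.
apply: (@det_qCartan Q (sg_quiver Sp) (@sg_base Q Sp) (fun t => (val t).1.2) base_src base_tgt
   _ _ _ (nonrelation I Sp) _ K (sg_gen I) _ _ _ C qC).
- by move=> v; exists (sg_plus v).
- move=> i a j ia ja; have [t tE] := tri ia ja; exists t.
  by split; rewrite /= tE.
- move=> t t' st tt pt; apply: val_inj; move: st tt pt => /=.
  by case: (val t) (val t') => [[? ?] ?] [[? ?] ?] /= -> -> ->.
- exact: nonrelation_comp.
(* At an ordinary vertex a generator is a single path, which is bad; at a special vertex it is the
   difference of the two lifts of a product. *)
- move=> x [a [b [i [k [ab Iab ia kb ->]]]]]; rewrite sum_sg_base.
  have [s [t [sE tE ->]]] := @sg_path2 i k (sg_plus (src b)) a b ia (esym ab) erefl kb.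
  have st : @is_qpath (sg_quiver Sp) i [:: s; t] by rewrite /= sE tE !eqxx.
  rewrite sg_sign_plus scale1r; case: ifP => bS.
    right; have mb : sg_base (sg_minus (src b)) = src b by rewrite /sg_base sg_minus_val.
    have ma := etrans mb (esym ab).
    have [s' [t' [s'E t'E ->]]] := @sg_path2 i k (sg_minus (src b)) a b ia ma mb kb.
    exists i, [:: s; t], [:: s'; t']; split=> //.
    + by rewrite /= s'E t'E !eqxx.
    + by rewrite /endpoint /= tE t'E.
    + by rewrite /= sE tE s'E t'E.
    by rewrite sg_sign_minus // scaleN1r.
  left; exists i, [:: s; t]; split=> //; last by rewrite addr0.
  rewrite /= sE tE /= andbT /nonrelation /= bS ab eqxx /=.
  by rewrite negbK; apply/asboolP.
- move=> s t st.
  have ss : tgt (val s).1.2 = src (val t).1.2 by rewrite -base_tgt st base_src.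
  rewrite /nonrelation /= ss eqxx /= negb_or negbK => /andP[nS /asboolP rst].
  exists (val s).1.2, (val t).1.2, (src s), (tgt t).
  split; [exact: ss | exact: rst | exact: base_src | exact: base_tgt |].
  rewrite sum_sg_base (negbTE nS) addr0 sg_sign_plus scale1r.
  have <- : tgt s = sg_plus (src (val t).1.2).
    case: (sg_cases (tgt s)); rewrite base_tgt ss // => -[].
    by rewrite (negbTE nS).
  exact: kpath2.
(* Two different lifts with common ends pass through the plus and the minus vertex in one order or
   the other, so their difference is a generator or its negative. *)
- move=> s t s' t' st st' ss tt ps pt ns x.
  have ab : tgt (val s).1.2 = src (val t).1.2 by rewrite -base_tgt st base_src.
  have ab' : tgt (val s').1.2 = src (val t).1.2 by rewrite -ps.
  have nj : tgt s <> tgt s'.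
    move=> E; apply: ns; apply: val_inj; move: ss E ps => /=.
    by case: (val s) (val s') => [[? ?] ?] [[? ?] ?] /= -> -> ->.
  have xE : x =
      kqmul (sg_karr K (src s) (val s).1.2 (tgt s))
            (sg_karr K (tgt s) (val t).1.2 (tgt t)) -
      kqmul (sg_karr K (src s) (val s).1.2 (tgt s'))
            (sg_karr K (tgt s') (val t).1.2 (tgt t)).
    by rewrite /x (kpath2 st) ss (kpath2 st') tt ps pt.
  have gen : src (val t).1.2 \in Sp -> sg_gen I
      (kqmul (sg_karr K (src s) (val s).1.2 (sg_plus (src (val t).1.2)))
             (sg_karr K (sg_plus (src (val t).1.2)) (val t).1.2 (tgt t))
      - kqmul (sg_karr K (src s) (val s).1.2 (sg_minus (src (val t).1.2)))
             (sg_karr K (sg_minus (src (val t).1.2)) (val t).1.2 (tgt t))).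
    move=> tS; exists (val s).1.2, (val t).1.2, (src s), (tgt t).
    split; [exact: ab | | exact: base_src | exact: base_tgt |].
      by case: sI => _ /(_ _ tS)[_]; apply.
    rewrite sum_sg_base tS sg_sign_plus (sg_sign_minus tS) scale1r scaleN1r.
    exact: erefl.
  have js : sg_base (tgt s) = src (val t).1.2 by rewrite base_tgt.
  have js' : sg_base (tgt s') = src (val t).1.2 by rewrite base_tgt.
  rewrite xE; case: (sg_cases (tgt s)); case: (sg_cases (tgt s')); rewrite js js'.
  + by move=> E E'; case: nj; rewrite E E'.
  + by move=> [tS ->] ->; left; apply: gen.
  + by move=> -> [tS ->]; right; rewrite opprB; apply: gen.
  by move=> [_ E] [_ E']; case: nj; rewrite E E'.
(* At a special vertex both relations hold and the fibre has two elements; elsewhere exactly one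
   holds and the fibre is a point. *)
move=> a c; rewrite card_sg_base /relation /nonrelation /=.
case: eqP => //= ac; rewrite !mul1n.
have [cS|//] := boolP (src c \in Sp); last by case: `[< _ >].
case: sI => _ /(_ _ cS)[_ H]; rewrite asboolT //; exact: H.
Qed.

End SkewGentle.

(** * Half-edges of the ribbon graph *)

Section DeterministicPaths.
Variables (T : eqType) (e : rel T).

Lemma stuck_path_exists N a : (forall z, path e a z -> (size z < N)%N) ->
  exists2 z, path e a z & forall b, ~~ e (last a z) b.
Proof.
elim: N a => [|N IH] a aN; first by have := aN [::] isT.
have [[b ab]|nab] := pselect (exists b, e a b); last first.
  by exists [::] => // b; apply/negP => ab; apply: nab; exists b.
have [|z bz zb] := IH b; last by exists (b :: z); rewrite /= ?ab.
by move=> z bz; have := aN (b :: z); rewrite /= ab bz => /(_ isT).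
Qed.

Lemma stuck_path_unique a z z' :
    (forall a b b', e a b -> e a b' -> b = b') ->
    path e a z -> (forall b, ~~ e (last a z) b) ->
    path e a z' -> (forall b, ~~ e (last a z') b) -> z = z'.
Proof.
move=> det; elim: z a z' => [|b z IH] a [|b' z'] //=.
- by move=> _ /(_ b') /negbTE ->.
- by move=> /andP[ab _] _ _ /(_ b); rewrite ab.
move=> /andP[ab bz] zb /andP[ab' bz'] zb'.
by have E := det _ _ _ ab ab'; subst b'; rewrite (IH b z').
Qed.

End DeterministicPaths.

Lemma sorted_rcons2 (T : Type) (e : rel T) u a b :
  sorted e (rcons (rcons u a) b) = sorted e (rcons u a) && e a b.
Proof. by case: u => [|c u] /=; rewrite ?andbT // !rcons_path last_rcons. Qed.

Lemma sorted_cat_cons (T : Type) (e : rel T) x a y :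
  sorted e (x ++ a :: y) = sorted e (rcons x a) && path e a y.
Proof. by case: x => [|c x] //=; rewrite cat_path rcons_path /= andbA. Qed.

Lemma head_rev_cat (T : Type) (a : T) u z : exists t, rev u ++ a :: z = last a u :: t.
Proof.
by case/lastP: u => [|u c]; [exists z | exists (rev u ++ a :: z); rewrite rev_rcons last_rcons].
Qed.

Lemma path_rev (T : Type) (e : rel T) a u :
  path (fun b c => e c b) a u = sorted e (rcons (rev u) a).
Proof. by rewrite -rev_cons rev_sorted. Qed.

Lemma card_le2_cases (T : finType) (A : {set T}) a a' c :
  (#|A| <= 2)%N -> a != a' -> a \in A -> a' \in A -> c \in A -> c = a \/ c = a'.
Proof.
move=> A2 aa' aA a'A cA; case: (eqVneq c a) => [|ca]; first by left.
case: (eqVneq c a') => [|ca']; first by right.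
have /subset_leq_card : [set c; a; a'] \subset A.
  by apply/subsetP => x; rewrite !inE => /orP[/orP[]|] /eqP ->.
rewrite -setUA cardsU1 cards2 !inE aa' negb_or ca ca' => /leq_trans /(_ A2).
by [].
Qed.

Lemma acyclic_uniq (T : finType) (e : rel T) a s :
  (forall a b, e a b -> ~~ connect e b a) -> path e a s -> uniq (a :: s).
Proof.
move=> acy; elim: s a => //= b s IH a /andP[ab bs].
have /= -> := IH _ bs; rewrite andbT; apply/negP => as_.
have /negP[] := acy _ _ ab; move: as_; rewrite in_cons => /predU1P[->|as_].
  exact: connect0.
case/splitPr: as_ bs => s1 s2; rewrite cat_path /= => /and3P[p1 p2 _].
apply/connectP; exists (rcons s1 a); rewrite ?last_rcons // rcons_path p1.
by rewrite p2.
Qed.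

Lemma endpoint_rcons (Q : quiver) (v : vert Q) u a : endpoint v (rcons u a) = tgt a.
Proof. by rewrite -cats1 endpoint_cat. Qed.

Section HalfEdges.
Variables (Q : quiver) (K : fieldType) (I : pathalg Q K -> Prop).
Hypothesis gI : gentle I.
Let B := nonrelation I set0.
Variable N : nat.
Hypothesis BN : forall a t, path B a t -> (size t < N)%N.

Let B_comp a b : B a b -> tgt a = src b.
Proof. exact: nonrelation_comp. Qed.

Let B_next a b b' : B a b -> B a b' -> b = b'.
Proof.
rewrite /B !nonrelation0 => /andP[/eqP ab nab] /andP[/eqP ab' nab'].
apply: (gentle_nonrel_next gI (a := a)) => r.
  by case/negP: nab; apply/relationP.
by case/negP: nab'; apply/relationP.
Qed.

Let B_prev a a' b : B a b -> B a' b -> a = a'.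
Proof.
rewrite /B !nonrelation0 => /andP[/eqP ab nab] /andP[/eqP ab' nab'].
apply: (gentle_nonrel_prev gI (a := b)) => r.
  by case/negP: nab; apply/relationP.
by case/negP: nab'; apply/relationP.
Qed.

Lemma relation_next a b b' : relation I a b -> relation I a b' -> b = b'.
Proof. by move=> /relationP[ab rab] /relationP[ab' rab']; apply: (gentle_rel_next gI ab). Qed.

Lemma relation_prev a a' b : relation I a b -> relation I a' b -> a = a'.
Proof. by move=> /relationP[ab rab] /relationP[ab' rab']; apply: (gentle_rel_prev gI ab). Qed.

Let composable_cases a b : tgt a = src b -> relation I a b \/ B a b.
Proof. by move=> ab; rewrite /B nonrelation0 ab eqxx; case: (relation I a b); [left|right]. Qed.

Let I0 : I 0.
Proof.
case: gI => _ _ _ _ _ _ [G _ IG] _; apply/IG; exists [::] => //.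
by rewrite big_nil.
Qed.

Lemma maximal_pathP v w : maximal_path I v w <->
  [/\ is_qpath v w, sorted B w, forall a, tgt a = v -> ~~ sorted B (a :: w) &
      forall a, src a = endpoint v w -> ~~ sorted B (rcons w a)].
Proof.
have gp := gentle_path gI.
have aw a : is_qpath v w -> tgt a = v -> is_qpath (src a) (a :: w).
  by move=> vw av; rewrite /= eqxx av.
have wa a : is_qpath v w -> src a = endpoint v w -> is_qpath v (rcons w a).
  by move=> vw av; rewrite -cats1 is_qpath_cat vw /= av eqxx.
split=> [[vw nI Il Ir]|[vw srt nl nr]].
  split=> //.
  - by apply/negPn/negP => /(gp _ _ vw).
  - move=> a av; apply/(gp _ _ (aw _ vw av)); have := Il a.
    by rewrite kqmul_kpath //= ?eqxx // -[endpoint _ [:: a]]/(tgt a) av eqxx.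
  move=> a av; apply/(gp _ _ (wa _ vw av)); have := Ir a.
  by rewrite kqmul_kpath //= ?eqxx // av eqxx cats1.
split=> //.
- by move/(gp _ _ vw); rewrite srt.
- move=> a; rewrite kqmul_kpath //= ?eqxx // -[endpoint _ [:: a]]/(tgt a); case: eqP => // av.
  by apply/(gp _ _ (aw _ vw av)); apply: nl.
move=> a; rewrite kqmul_kpath //= ?eqxx //; case: eqP => // av.
by rewrite cats1; apply/(gp _ _ (wa _ vw (esym av))); apply: nr.
Qed.

(** * The arrows on either side of a half-edge *)

Let H := rg_half I.
Implicit Types h : H.

Definition hstart h : vert Q := (val h).1.1.1.
Definition hword h : seq (arr Q) := (val h).1.1.2.
Definition hpos h : nat := (val h).2.
(** A half-edge is a position in a word, and it is handled through the arrows just after it ([hout])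
    and just before it ([hin]); [None] marks the end or the beginning of the word. *)
Definition hout h : option (arr Q) := ohead (drop (hpos h) (hword h)).
Definition hin h : option (arr Q) := ohead (rev (take (hpos h) (hword h))).

Let hE h : rg_edge h = endpoint (hstart h) (take (hpos h) (hword h)).
Proof. by rewrite /rg_edge /hstart /hword /hpos; case: (val h) => [[[v w] t] k]. Qed.

Let hpos_le h : (hpos h <= size (hword h))%N.
Proof. by case/andP: (valP h). Qed.

Let half_cases h :
  (hword h = [::] /\ (val h).1.2 = true /\ trivial_vertex I (hstart h)) \/
  ((val h).1.2 = false /\ maximal_path I (hstart h) (hword h)).
Proof.
rewrite /hstart /hword; case/andP: (valP h) => + _.
case: (val h) => [[[v w] []] k] /=; last by move/asboolP; right.
by case/andP => /nilP ? /asboolP ?; left.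
Qed.

Let half_path h : is_qpath (hstart h) (hword h) /\ sorted B (hword h).
Proof.
case: (half_cases h) => [[-> _] //|[_ /maximal_pathP[]] //].
Qed.

Let half_eq h h' : hstart h = hstart h' -> hword h = hword h' ->
  (val h).1.2 = (val h').1.2 -> hpos h = hpos h' -> h = h'.
Proof.
rewrite /hstart /hword /hpos => E1 E2 E3 E4; apply: val_inj; move: E1 E2 E3 E4.
case: (val h) (val h') => [[[v w] t] k] [[[v' w'] t'] k'] /= -> /val_inj -> -> /val_inj ->.
by [].
Qed.

Let hout_split h a : hout h = Some a ->
  hword h = take (hpos h) (hword h) ++ a :: drop (hpos h).+1 (hword h).
Proof.
rewrite /hout => E; rewrite -[LHS](cat_take_drop (hpos h)); congr (_ ++ _).
by case: (drop _ _) E (drop_drop (hword h) 1 (hpos h)) => //= b s [->]; rewrite drop0 add1n => <-.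
Qed.

Let hin_split h a : hin h = Some a ->
  exists2 u, take (hpos h) (hword h) = rcons u a & hpos h = (size u).+1.
Proof.
rewrite /hin; case/lastP E: (take _ _) => [//|u b].
rewrite rev_rcons /= => -[<-]; exists u => //.
by have := congr1 size E; rewrite size_rcons size_takel.
Qed.

Lemma hout_src h a : hout h = Some a -> rg_edge h = src a.
Proof.
move=> /hout_split E; have [+ _] := half_path h.
by rewrite E is_qpath_cat /= => /and3P[_ /eqP-> _]; rewrite hE.
Qed.

Lemma hin_tgt h a : hin h = Some a -> rg_edge h = tgt a.
Proof.
by case/hin_split => u E _; rewrite hE E endpoint_rcons.
Qed.

Lemma hin_hout h a b : hin h = Some a -> hout h = Some b -> B a b.
Proof.
case/hin_split => u E _ /hout_split E'; have [_] := half_path h.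
rewrite E' E cat_rcons => /cat_sorted2[_] /=.
by case/andP.
Qed.

Let hword_maximal h : hword h <> [::] -> maximal_path I (hstart h) (hword h).
Proof. by case: (half_cases h) => [[]|[]]. Qed.

(** A maximal word cannot stop after [a] while some product [ab] is nonzero, and the arrow with
    which it continues is unique. [hout_prev] is the mirror image. *)
Lemma hin_next h a b : hin h = Some a -> B a b -> hout h = Some b.
Proof.
move=> ha ab; have [u E _] := hin_split ha.
case E' : (hout h) => [c|]; first by rewrite (B_next ab (hin_hout ha E')).
have w0 : hword h <> [::] by move=> w0; move: E; rewrite w0 /=; case: u.
have /maximal_pathP[_ srt _ nr] := hword_maximal w0.
have d0 : drop (hpos h) (hword h) = [::] by move: E'; rewrite /hout; case: (drop _ _).
have wE : hword h = rcons u a by rewrite -(cat_take_drop (hpos h) (hword h)) d0 cats0.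
have := nr b; rewrite wE endpoint_rcons (B_comp ab) => /(_ erefl).
by rewrite sorted_rcons2 ab -wE srt.
Qed.

Lemma hout_prev h a b : hout h = Some b -> B a b -> hin h = Some a.
Proof.
move=> hb ab; have E := hout_split hb.
case E' : (hin h) => [c|]; first by rewrite (B_prev ab (hin_hout E' hb)).
have t0 : take (hpos h) (hword h) = [::].
  by move: E'; rewrite /hin; case/lastP: (take _ _) => // u x; rewrite rev_rcons.
have w0 : hword h <> [::] by rewrite E t0.
have /maximal_pathP[] := hword_maximal w0; rewrite E t0 /= => /andP[/eqP bs _] srt nl _.
by have := nl a; rewrite -bs (B_comp ab) ab srt => /(_ erefl).
Qed.

Lemma succ_hout h h' : rg_succ h = Some h' ->
  exists2 a, hout h = Some a & hin h' = Some a.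
Proof.
rewrite /rg_succ; case: pickP => // z /andP[/eqP E1 /eqP E2] [<-].
have sz : (hpos h < size (hword h))%N.
  by have := hpos_le z; rewrite /hpos /hword E1 E2.
case E : (drop (hpos h) (hword h)) => [|a s].
  by have := congr1 size E; rewrite size_drop /= => /eqP; rewrite subn_eq0 leqNgt sz.
exists a; first by rewrite /hout E.
rewrite /hin /hpos /hword E1 E2 -/(hpos h) -/(hword h).
rewrite (take_nth a) // rev_rcons /= -[hpos h]addn0 -nth_drop E //.
Qed.

Lemma hout_succ h a : hout h = Some a -> exists h', rg_succ h = Some h'.
Proof.
move=> ha; rewrite /rg_succ; case: pickP => [h'|]; first by exists h'.
have E := hout_split ha.
have sz : (hpos h < size (hword h))%N.
  by rewrite E size_cat /= addnS ltnS size_takel ?leq_addr // hpos_le.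
have sz' : ((hpos h).+1 < #|arr Q|.+1)%N.
  by rewrite ltnS (leq_trans sz) // /hword size_bseq.
have P : rg_vertex I (val h).1 && ((hpos h).+1 <= size (val h).1.1.2)%N.
  by case/andP: (valP h) => -> _.
move/(_ (exist _ ((val h).1, Ordinal sz') P)).
by rewrite /= !eqxx.
Qed.

Lemma hin_pred h a : hin h = Some a -> exists2 h', rg_succ h' = Some h & hout h' = Some a.
Proof.
move=> ha; have [u E pE] := hin_split ha.
have lt : (size u < #|arr Q|.+1)%N.
  by apply: ltn_trans (ltn_ord (val h).2); rewrite -/(hpos h) pE.
have P : rg_vertex I (val h).1 && (size u <= size (val h).1.1.2)%N.
  case/andP: (valP h) => -> _ /=; apply: leq_trans (hpos_le h).
  by rewrite pE.
pose h' : H := exist _ ((val h).1, Ordinal lt) P.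
have : rg_succ h' = Some h.
  rewrite /rg_succ; case: pickP => [z|/(_ h)]; last by rewrite /= eqxx -pE -/(hpos h) eqxx.
  move=> /andP[/eqP E1 /eqP E2]; congr Some; apply: half_eq.
  - by rewrite /hstart E1.
  - by rewrite /hword E1.
  - by rewrite E1.
  by rewrite /hpos E2 /= -pE.
move=> E'; exists h' => //; have [b hb hb'] := succ_hout E'.
by rewrite hb -hb' ha.
Qed.

Let B_acyclic := bounded_acyclic BN.

(** An arrow extends in only one way to the right and to the left until it gets stuck, so it
    determines the maximal word and its own position there. *)
Lemma hout_inj h h' a : hout h = Some a -> hout h' = Some a -> h = h'.
Proof.
move=> ha ha'; have E := hout_split ha; have E' := hout_split ha'.
set u := take (hpos h) _ in E; set z := drop _ _ in E.
set u' := take (hpos h') _ in E'; set z' := drop _ _ in E'.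
have w0 : hword h <> [::] by rewrite E; case: (u).
have w0' : hword h' <> [::] by rewrite E'; case: (u').
(* Around [a], a maximal word splits into a stuck path for [B] and, read backwards, a stuck path for
   the converse of [B]. *)
have key (k : H) (x y : seq (arr Q)) : hword k = x ++ a :: y ->
    [/\ path B a y, forall b, ~~ B (last a y) b,
      path (fun b c => B c b) a (rev x), forall b, ~~ B b (last a (rev x)) &
      hstart k = src (last a (rev x))].
  move=> Ek; have : hword k <> [::] by rewrite Ek; case: (x).
  move/hword_maximal/maximal_pathP; rewrite Ek => -[vw srt nl nr].
  have [t Et] := head_rev_cat a (rev x) y; rewrite revK in Et.
  move: (srt); rewrite sorted_cat_cons => /andP[sx sy]; split=> //.
  - move=> b; apply/negP => lb; have := nr b.
    rewrite -(B_comp lb) lastI -rcons_cat endpoint_rcons => /(_ erefl).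
    by rewrite sorted_rcons2 lb rcons_cat -lastI srt.
  - by rewrite path_rev revK.
  - move=> b; apply/negP => lb; have := nl b.
    rewrite (B_comp lb); move: vw srt; rewrite Et /= => /andP[/eqP -> _] pt.
    by rewrite lb pt => /(_ erefl).
  by move: vw; rewrite Et => /andP[/eqP].
have [pz sz pu su hs] := key _ _ _ E; have [pz' sz' pu' su' hs'] := key _ _ _ E'.
have zz : z = z' by apply: (stuck_path_unique B_next pz sz pz' sz').
have uu : rev u = rev u'.
  apply: (@stuck_path_unique _ (fun b c => B c b) a _ _ _ pu su pu' su').
  by move=> x y y' /= h1 h2; apply: B_prev h1 h2.
apply: half_eq.
- by rewrite hs hs' uu.
- by rewrite E E' zz -[u]revK uu revK.
- by case: (half_cases h) (half_cases h') => [[]//|[-> _]] [[]//|[-> _]].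
have := congr1 size uu; rewrite !size_rev /u /u' !size_takel //.
Qed.

Lemma hin_inj h h' a : hin h = Some a -> hin h' = Some a -> h = h'.
Proof.
move=> /hin_pred[k ks ka] /hin_pred[k' ks' ka'].
by move: ks; rewrite (hout_inj ka ka') ks' => -[].
Qed.

(** Extending [a] both ways until stuck gives a maximal path. It repeats no arrow because [B] is
    acyclic, so it fits the length bound built into [rg_word]. *)
Lemma hout_exists a : exists h, hout h = Some a.
Proof.
have [z pz sz] := stuck_path_exists (@BN a).
have [|u pu su] := @stuck_path_exists _ (fun b c => B c b) N a.
  move=> z'; rewrite path_rev; have [t Et] := head_rev_cat a z' [::].
  rewrite -cats1 Et => /BN; have := congr1 size Et.
  by rewrite size_cat size_rev /= addn1 => -[->].
have srt : sorted B (rev u ++ a :: z).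
  by rewrite sorted_cat_cons pz andbT -(path_rev B a u); exact: pu.
have [t Et] := head_rev_cat a u z.
have szw : (size (rev u ++ a :: z) <= #|arr Q|)%N.
  rewrite -(card_uniqP _) ?max_card //; move: srt; rewrite Et.
  exact: acyclic_uniq B_acyclic.
have mx : maximal_path I (src (last a u)) (rev u ++ a :: z).
  apply/maximal_pathP; split=> //.
  - by move: srt; rewrite Et /= eqxx => /(path_qpath B_comp).
  - move=> c cl; rewrite Et /=; apply/nandP; left; exact: su.
  move=> b; rewrite lastI -rcons_cat sorted_rcons2 => _.
  by apply/nandP; right; apply: sz.
have P : rg_vertex I (src (last a u), Bseq szw, false) && (size u <= size (rev u ++ a :: z))%N.
  by rewrite /rg_vertex asboolT //= size_cat size_rev leq_addr.
have lt : (size u < #|arr Q|.+1)%N.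
  by rewrite ltnS; apply: leq_trans (szw); rewrite size_cat size_rev leq_addr.
exists (exist _ ((src (last a u), Bseq szw, false), Ordinal lt) P).
by rewrite /hout /hpos /hword /= drop_cat size_rev ltnn subnn.
Qed.

Lemma hin_exists a : exists h, hin h = Some a.
Proof.
have [h ha] := hout_exists a; have [h' hh'] := hout_succ ha.
by have [b hb hb'] := succ_hout hh'; exists h'; rewrite hb' -hb.
Qed.


(** * Half-edges on trivial paths, and the two ends of an edge *)

Let lone_word h : hin h = None -> hout h = None -> hword h = [::].
Proof.
rewrite /hin /hout -{3}(cat_take_drop (hpos h) (hword h)).
case/lastP: (take _ _) => [|u a]; last by rewrite rev_rcons.
by case: (drop _ _).
Qed.

Let lone_pos h : hin h = None -> hout h = None -> hpos h = 0%N.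
Proof. by move=> h0 h1; have := hpos_le h; rewrite lone_word // leqn0 => /eqP. Qed.

Let lone_edge h : hin h = None -> hout h = None -> rg_edge h = hstart h.
Proof. by move=> h0 h1; rewrite hE lone_word. Qed.

(** Two kinds of trivial path occur: the additional ones, marked by the tag, and [e_v] as a maximal
    path, which happens only if no arrow meets [v]. *)
Let loneP h : hin h = None -> hout h = None ->
  ((val h).1.2 /\ trivial_vertex I (rg_edge h)) \/
  ((val h).1.2 = false /\ forall a, tgt a <> rg_edge h /\ src a <> rg_edge h).
Proof.
move=> h0 h1; rewrite lone_edge //; case: (half_cases h) => [[_ [-> tv]]|[-> mx]].
  by left.
right; split=> // a; move/maximal_pathP: mx; rewrite lone_word // => -[_ _ nl nr].
by split=> [/nl|/nr].
Qed.

Let lone_inj h h' : hin h = None -> hout h = None -> hin h' = None -> hout h' = None ->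
  rg_edge h = rg_edge h' -> (val h).1.2 = (val h').1.2 -> h = h'.
Proof.
move=> a b c d E F; apply: half_eq; rewrite ?lone_word ?lone_pos //.
by rewrite -!lone_edge.
Qed.

Let lone_exists v t : (if t then trivial_vertex I v else forall a, tgt a <> v /\ src a <> v) ->
  exists h : H, [/\ hin h = None, hout h = None, rg_edge h = v & (val h).1.2 = t].
Proof.
move=> vt; pose m : rg_word Q := (v, nil_bseq #|arr Q| (arr Q), t).
have P : rg_vertex I m && (0 <= size m.1.2)%N.
  rewrite andbT /= -/m; case: t vt @m => vt; apply/asboolP => //.
  by apply/maximal_pathP; split=> // a av; case: (vt a).
by exists (exist _ (m, ord0) P).
Qed.

(** With two arrows entering [v], their ends are the two half-edges: an arrow leaving [v] forms a
    relation with at most one of them and so continues the other. Two arrows leaving are symmetric.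
    With one in and one out, the half-edges are distinct if the product is a relation; otherwise
    they coincide and the second one is the additional trivial path. That path is also the second
    half-edge when a single arrow meets [v]; at an isolated vertex both are trivial, with different
    tags. *)
Lemma two_halves v : exists h1 h2 : H,
  [/\ h1 != h2, rg_edge h1 = v, rg_edge h2 = v & forall h, rg_edge h = v -> h = h1 \/ h = h2].
Proof.
have inA a : tgt a = v -> a \in in_arrows v by move=> av; rewrite inE av.
have outA a : src a = v -> a \in out_arrows v by move=> av; rewrite inE av.
have Ain a : a \in in_arrows v -> tgt a = v by rewrite inE => /eqP.
have Aout a : a \in out_arrows v -> src a = v by rewrite inE => /eqP.
have [[a [a' [av a'v aa']]]|nin] :=
    pselect (exists a a', [/\ tgt a = v, tgt a' = v & a != a']).
  have [h ha] := hin_exists a; have [h' ha'] := hin_exists a'.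
  exists h, h'; split; rewrite ?(hin_tgt ha) ?(hin_tgt ha') //.
    by apply: contra aa' => /eqP E; move: ha'; rewrite -E ha => -[->].
  move=> k kv; case E : (hin k) => [c|].
    have cv : tgt c = v by rewrite -(hin_tgt E).
    have [Ec|Ec] := card_le2_cases (gentle_in gI v) aa' (inA _ av) (inA _ a'v) (inA _ cv).
      by left; apply: (hin_inj E); rewrite Ec.
    by right; apply: (hin_inj E); rewrite Ec.
  case E' : (hout k) => [b|].
    have bv : src b = v by rewrite -(hout_src E').
    case: (composable_cases (etrans av (esym bv))) => [r|ab]; last first.
      by rewrite (hout_prev E' ab) in E.
    case: (composable_cases (etrans a'v (esym bv))) => [r'|ab]; last first.
      by rewrite (hout_prev E' ab) in E.
    by case/eqP: aa'; apply: relation_prev r r'.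
  case: (loneP E E') => [[_]|[_ /(_ a)[]]]; last by rewrite kv.
  rewrite kv => -[le1|[a0 [b0 [ia _ _]]]].
    have : (2 <= #|in_arrows v|)%N by apply/card_gt1P; exists a, a'; rewrite !inA.
    by rewrite leqNgt ltnS (leq_trans _ le1) // leq_addr.
  move: (inA _ av) (inA _ a'v); rewrite ia !inE => /eqP E1 /eqP E2.
  by rewrite E1 E2 eqxx in aa'.
have [[b [b' [bv b'v bb']]]|nout] :=
    pselect (exists b b', [/\ src b = v, src b' = v & b != b']).
  have [h hb] := hout_exists b; have [h' hb'] := hout_exists b'.
  exists h, h'; split; rewrite ?(hout_src hb) ?(hout_src hb') //.
    by apply: contra bb' => /eqP E; move: hb'; rewrite -E hb => -[->].
  move=> k kv; case E : (hout k) => [c|].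
    have cv : src c = v by rewrite -(hout_src E).
    have [Ec|Ec] := card_le2_cases (gentle_out gI v) bb' (outA _ bv) (outA _ b'v) (outA _ cv).
      by left; apply: (hout_inj E); rewrite Ec.
    by right; apply: (hout_inj E); rewrite Ec.
  case E' : (hin k) => [a|].
    have av : tgt a = v by rewrite -(hin_tgt E').
    case: (composable_cases (etrans av (esym bv))) => [r|ab]; last first.
      by rewrite (hin_next E' ab) in E.
    case: (composable_cases (etrans av (esym b'v))) => [r'|ab]; last first.
      by rewrite (hin_next E' ab) in E.
    by case/eqP: bb'; apply: relation_next r r'.
  case: (loneP E' E) => [[_]|[_ /(_ b)[]]]; last by rewrite kv.
  rewrite kv => -[le1|[a0 [b0 [_ ib _]]]].
    have : (2 <= #|out_arrows v|)%N by apply/card_gt1P; exists b, b'; rewrite !outA.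
    by rewrite leqNgt ltnS (leq_trans _ le1) // leq_addl.
  move: (outA _ bv) (outA _ b'v); rewrite ib !inE => /eqP E1 /eqP E2.
  by rewrite E1 E2 eqxx in bb'.
have in_uniq a a' : tgt a = v -> tgt a' = v -> a = a'.
  by move=> av a'v; apply/eqP/negPn/negP => aa'; apply: nin; exists a, a'.
have out_uniq a a' : src a = v -> src a' = v -> a = a'.
  by move=> av a'v; apply/eqP/negPn/negP => aa'; apply: nout; exists a, a'.
have in1 a : tgt a = v -> in_arrows v = [set a].
  move=> av; apply/setP => c; rewrite !inE; apply/eqP/eqP => [/in_uniq|->//]; exact.
have out1 a : src a = v -> out_arrows v = [set a].
  move=> av; apply/setP => c; rewrite !inE; apply/eqP/eqP => [/out_uniq|->//]; exact.
have in0 : ~ (exists a, tgt a = v) -> in_arrows v = set0.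
  by move=> n; apply/setP => c; rewrite !inE; apply/negP => /eqP cv; apply: n; exists c.
have out0 : ~ (exists a, src a = v) -> out_arrows v = set0.
  by move=> n; apply/setP => c; rewrite !inE; apply/negP => /eqP cv; apply: n; exists c.
have [[a av]|noin] := pselect (exists a, tgt a = v);
  have [[b bv]|noout] := pselect (exists b, src b = v).
- have [h ha] := hin_exists a; have [h' hb] := hout_exists b.
  case: (composable_cases (etrans av (esym bv))) => [r|ab].
    exists h, h'; split; rewrite ?(hin_tgt ha) ?(hout_src hb) //.
      apply/eqP => E; subst h'; have := hin_hout ha hb.
      by rewrite /B nonrelation0 r andbF.
    move=> k kv; case E : (hin k) => [c|].
      left; apply: (hin_inj E); rewrite ha; congr Some.
      by apply: in_uniq => //; rewrite -(hin_tgt E).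
    case E' : (hout k) => [c|].
      right; apply: (hout_inj E'); rewrite hb; congr Some.
      by apply: out_uniq => //; rewrite -(hout_src E').
    case: (loneP E E') => [[_]|[_ /(_ a)[]]]; last by rewrite kv.
    rewrite kv => -[|[a0 [b0 [ia ib]]]]; first by rewrite (in1 a) // (out1 b) // !cards1.
    case; move: r => /relationP[_].
    move: (inA _ av) (outA _ bv); rewrite ia ib !inE => /eqP -> /eqP ->.
    by [].
  have tv : trivial_vertex I v.
    right; exists a, b; split; [exact: in1 | exact: out1 |].
    move: ab; rewrite /B nonrelation0 => /andP[/eqP ab nr] r.
    by case/negP: nr; apply/relationP.
  have [h0 [i0 o0 e0 t0]] := @lone_exists v true tv.
  exists h, h0; split; rewrite ?(hin_tgt ha) //.
    by apply/eqP => E; move: i0; rewrite -E ha.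
  move=> k kv; case E : (hin k) => [c|].
    left; apply: (hin_inj E); rewrite ha; congr Some.
    by apply: in_uniq => //; rewrite -(hin_tgt E).
  case E' : (hout k) => [c|].
    have Ec : c = b by apply: out_uniq => //; rewrite -(hout_src E').
    by subst c; rewrite (hout_prev E' ab) in E.
  right; apply: lone_inj => //; first by rewrite e0.
  by case: (loneP E E') => [[]|[_ /(_ a)[]]]; rewrite ?kv ?t0.
- have [h ha] := hin_exists a.
  have tv : trivial_vertex I v by left; rewrite (in1 a) // out0 // cards1 cards0.
  have [h0 [i0 o0 e0 t0]] := @lone_exists v true tv.
  exists h, h0; split; rewrite ?(hin_tgt ha) //.
    by apply/eqP => E; move: i0; rewrite -E ha.
  move=> k kv; case E : (hin k) => [c|].
    left; apply: (hin_inj E); rewrite ha; congr Some.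
    by apply: in_uniq => //; rewrite -(hin_tgt E).
  case E' : (hout k) => [c|].
    by case: noout; exists c; rewrite -(hout_src E').
  right; apply: lone_inj => //; first by rewrite e0.
  by case: (loneP E E') => [[]|[_ /(_ a)[]]]; rewrite ?kv ?t0.
- have [h hb] := hout_exists b.
  have tv : trivial_vertex I v by left; rewrite (out1 b) // in0 // cards1 cards0.
  have [h0 [i0 o0 e0 t0]] := @lone_exists v true tv.
  exists h, h0; split; rewrite ?(hout_src hb) //.
    by apply/eqP => E; move: o0; rewrite -E hb.
  move=> k kv; case E : (hout k) => [c|].
    left; apply: (hout_inj E); rewrite hb; congr Some.
    by apply: out_uniq => //; rewrite -(hout_src E).
  case E' : (hin k) => [c|].
    by case: noin; exists c; rewrite -(hin_tgt E').
  right; apply: lone_inj => //; first by rewrite e0.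
  by case: (loneP E' E) => [[]|[_ /(_ b)[]]]; rewrite ?kv ?t0.
have tv : trivial_vertex I v by left; rewrite out0 // in0 // cards0.
have [h0 [i0 o0 e0 t0]] := @lone_exists v true tv.
have [|h1 [i1 o1 e1 t1]] := @lone_exists v false.
  by move=> a; split=> av; [apply: noin|apply: noout]; exists a.
exists h0, h1; split=> //; first by apply/eqP => E; move: t0; rewrite E t1.
move=> k kv; case E : (hin k) => [c|]; first by case: noin; exists c; rewrite -(hin_tgt E).
case E' : (hout k) => [c|]; first by case: noout; exists c; rewrite -(hout_src E').
case T : ((val k).1.2); [left|right]; apply: lone_inj; rewrite ?e0 ?e1 ?T ?t0 ?t1 //.
Qed.

Lemma rg_other_edge h : rg_edge (rg_other h) = rg_edge h.
Proof. by rewrite /rg_other; case: pickP => [h' /andP[/eqP]|]. Qed.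

Lemma rg_other_neq h : rg_other h != h.
Proof.
have [h1 [h2 [n12 e1 e2 all]]] := two_halves (rg_edge h).
rewrite /rg_other; case: pickP => [h' /andP[]//|no].
have := no h1; have := no h2; rewrite e1 e2 eqxx /= => /negbFE/eqP E /negbFE/eqP E'.
by rewrite E E' eqxx in n12.
Qed.

Lemma rg_other_unique h h' : rg_edge h' = rg_edge h -> h' != h -> h' = rg_other h.
Proof.
move=> e ne; have [h1 [h2 [n12 e1 e2 all]]] := two_halves (rg_edge h).
move: ne (rg_other_neq h); case: (all _ erefl) => E.
  by case: (all _ e) (all _ (rg_other_edge h)) => [->|->] [->|->]; rewrite -?E ?eqxx.
by case: (all _ e) (all _ (rg_other_edge h)) => [->|->] [->|->]; rewrite -?E ?eqxx.
Qed.

Lemma rg_otherK : involutive (rg_other (I := I)).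
Proof.
move=> h; apply/esym/rg_other_unique; first by rewrite rg_other_edge.
by rewrite eq_sym rg_other_neq.
Qed.

(** If [ab] were nonzero, [b] would follow [a] at the same half-edge. Hence crossing to the other
    end of the edge selects the arrow that forms a relation with [a]. *)
Lemma relation_other h a b : hin h = Some a ->
  (hout (rg_other h) == Some b) = relation I a b.
Proof.
move=> ha; apply/eqP/idP => [hb|rab].
  have ab : tgt a = src b by rewrite -(hin_tgt ha) -(hout_src hb) rg_other_edge.
  case: (composable_cases ab) => // /(hin_next ha) hb'.
  by have := rg_other_neq h; rewrite (hout_inj hb hb') eqxx.
have [k kb] := hout_exists b; have /relationP[ab _] := rab.
have E : k = rg_other h.
  apply: rg_other_unique; first by rewrite (hin_tgt ha) (hout_src kb).
  apply/eqP => E; subst k; have := hin_hout ha kb.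
  by rewrite /B nonrelation0 rab andbF.
by rewrite -E.
Qed.

End HalfEdges.

(** * The turning matrix *)

Section RibbonDeterminant.
Variables (Q : quiver) (K : fieldType) (I : pathalg Q K -> Prop) (Sp : {set vert Q}).
Hypothesis sI : skew_gentle I Sp.
Let gI : gentle I := proj1 sI.
Variable N : nat.
Hypothesis BN : forall a t, path (nonrelation I set0) a t -> (size t < N)%N.

Let H : finType := rg_half I.
Let g := sg_ribbon I Sp.
Let o (h : H) : H := rg_other h.
Let D (h : H) : bool := @digon (vert Q) (gentle_ribbon I) Sp h.
Implicit Types h : H.

Let oK : involutive o. Proof. exact: rg_otherK gI _ BN. Qed.
Let o_neq h : o h != h. Proof. exact: rg_other_neq gI _ BN _. Qed.

Let digon_hin h : D h -> hin h = None.
Proof.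
case/and3P => _ /forallP first _; case E : (hin h) => [a|//].
by have [h' sh _] := hin_pred E; have := first h'; rewrite /= sh eqxx.
Qed.

Let digon_hout h : D h -> hout (o h) = None.
Proof.
case/and3P => _ _ /eqP last; case E : (hout (o h)) => [a|//].
have [h'] := hout_succ E; pose h0 : half_edge (gentle_ribbon I) := h.
by rewrite -[rg_succ _]/(succ (other h0)) last.
Qed.

(** With digons on both sides no arrow would meet the edge, whereas a special vertex is the start or
    the end of an arrow. *)
Let digon_excl h : D h -> D (o h) = false.
Proof.
move=> Dh; apply/negP => Doh.
have i0 := digon_hin Dh; have o1 := digon_hout Dh.
have i1 := digon_hin Doh; have := digon_hout Doh; rewrite oK => o0.
have vS : rg_edge h \in Sp by case/and3P: Dh.
have arrowless h' : rg_edge h' = rg_edge h -> hin h' = None /\ hout h' = None.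
  move=> e; have [->//|ne] := eqVneq h' h.
  by rewrite (rg_other_unique gI BN e ne).
case: sI => _ /(_ _ vS)[[|] /eqP/cards1P[a aE] _].
  have [k ka] := hout_exists gI BN a; have [|_] := arrowless k; last by rewrite ka.
  have : a \in out_arrows (rg_edge h) by rewrite aE inE.
  by rewrite inE (hout_src gI ka) => /eqP.
have [k ka] := hin_exists gI BN a; have [|] := arrowless k; last by rewrite ka.
have : a \in in_arrows (rg_edge h) by rewrite aE inE.
by rewrite inE (hin_tgt ka) => /eqP.
Qed.

(** The original half-edge after which the turn continues, if it does not lead to an orbifold point.
    When the edge is travelled back from the orbifold point, [o h] at the glued vertex is followed
    by what used to follow [h]. *)
Let y h : H := if D h then h else o h.

Let turnE h : @turn _ g h = if D (o h) then Some (o h) else rg_succ (y h).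
Proof.
rewrite -[turn _]/(if D (o h) then Some (o h)
                  else if D (o (o h)) then rg_succ (o (o h)) else rg_succ (o h)).
by rewrite oK /y; case: (D h).
Qed.

Let first_digon h h' : D h -> rg_succ h' <> Some h.
Proof. by move=> /digon_hin h0 /succ_hout[a _]; rewrite h0. Qed.

(** A half-edge at an orbifold point was first at its original vertex, hence is no [rg_succ]. Any
    other turn crosses an arrow, which is determined by the half-edge it leads to. *)
Lemma turn_sg_inj (h h' z : half_edge g) : turn h = Some z -> turn h' = Some z -> h = h'.
Proof.
rewrite !turnE; case: ifP => Dh; case: ifP => Dh'.
- by move=> [<-] [/(can_inj oK)].
- by move=> [<-] /(first_digon Dh).
- by move=> + [E]; rewrite -E => /(first_digon Dh').
move=> /succ_hout[a ya az] /succ_hout[b yb]; rewrite az => -[E]; subst b.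
have := hout_inj gI ya yb; rewrite /y.
case: ifP => Dy; case: ifP => Dy' // E.
- by move: Dh'; rewrite -E Dy.
- by move: Dh; rewrite E Dy'.
exact: (can_inj oK).
Qed.

(* The step towards an orbifold point gets weight -1, so that it does not
   contribute to the product of the - x h along a polygon. *)
Let x h : {poly int} := if D (o h) then -1 else 'X.

(* Turning either goes to an orbifold point, which Z records, or traverses an
   arrow, so that the rest of the turning matrix factors through the arrows as
   U V; and V U is the matrix of relations. *)
Lemma det_relation_mx :
  \det (1%:M + 'X *: rel_mx {poly int} (relation I)) = \det (@cut_mx _ g _ x set0).
Proof.
pose Z : 'M[{poly int}]_#|H| :=
  \matrix_(i, j) (- (D (o (enum_val i)) && (enum_val j == o (enum_val i)))%:R).
pose U : 'M[{poly int}]_(#|H|, #|arr Q|) :=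
  \matrix_(i, b) (hout (y (enum_val i)) == Some (enum_val b))%:R.
pose V : 'M[{poly int}]_(#|arr Q|, #|H|) :=
  \matrix_(b, j) (hin (enum_val j) == Some (enum_val b))%:R.
(* Two steps to orbifold points never follow each other, since [D] excludes one of the two ends of
   an edge. *)
have dZ : \det (1%:M + Z) = 1.
  apply: (@det_acyclic _ _ [rel h h' | D (o h) && (h' == o h)]).
  - move=> h h' /andP[Dh /eqP->]; apply/negP => /connectP[[|k s] /=].
      by move=> _ E; have := o_neq h; rewrite -E eqxx.
    by rewrite oK => /andP[/andP[Dh']]; have := digon_excl Dh'; rewrite Dh.
  - by move=> h; rewrite !mxE eqxx !enum_rankK eq_sym (negbTE (o_neq h)) andbF oppr0 addr0.
  move=> h h' ne; rewrite !mxE !enum_rankK (inj_eq enum_rank_inj) (negbTE ne) add0r /=.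
  by case: (_ && _) => //; rewrite oppr0 eqxx.
have -> : @cut_mx _ g _ x set0 = (1%:M + Z) *m (1%:M + ('X *: U) *m V).
  rewrite mulmxDr mulmx1 mulmxA -scalemxAr -addrA.
  apply/matrixP => i j; rewrite -[i]enum_valK -[j]enum_valK.
  set h := enum_val i; set h' := enum_val j.
  rewrite (@cut_mxE _ g _ x set0 h h') [RHS]mxE [in RHS]mxE (inj_eq enum_rank_inj).
  congr (_ + _); rewrite in_set0 turnE [~~ _ && _]/=.
  (* If [D (o h)], then [y h] and [y (o h)] are both [o h], so the rows of [U] at [h] and [o h]
     agree and the entry -1 of [Z] cancels them: such a turn crosses no arrow. *)
  have ZU b : ((1%:M + Z) *m U) (enum_rank h) b =
      (~~ D (o h) && (hout (y h) == Some (enum_val b)))%:R.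
    rewrite mulmxDl mul1mx !mxE enum_rankK (bigD1 (enum_rank (o h))) //= big1 => [|k kn].
      rewrite !mxE !enum_rankK eqxx andbT addr0.
      case Dh: (D (o h)) => /=; last by rewrite oppr0 mul0r addr0.
      have := digon_excl Dh; rewrite oK => Dh'.
      by rewrite /y Dh Dh' mulN1r subrr.
    rewrite !mxE enum_rankK; case: (eqVneq (enum_val k) (o h)) => [E|]; last first.
      by rewrite andbF oppr0 mul0r.
    by case/eqP: kn; rewrite -E enum_valK.
  rewrite mxE [RHS]addrC -scalemxAl mxE mxE.
  under eq_bigr do rewrite ZU mxE enum_rankK.
  rewrite mxE !enum_rankK /x.
  case Dh: (D (o h)) => /=.
    rewrite big1 ?mulr0 ?add0r => [|b _]; last by rewrite mulr0n mul0r.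
    rewrite (inj_eq (@Some_inj _)) eq_sym; case: (h' == o h) => /=; first exact: erefl.
    by rewrite oppr0.
  rewrite oppr0 addr0.
  have E : (rg_succ (y h) == Some h') = [exists b, (hout (y h) == Some b) && (hin h' == Some b)].
    apply/eqP/existsP => [/succ_hout[b -> ->]|[b /andP[/eqP yb /eqP hb]]].
      by exists b; rewrite !eqxx.
    have [z yz] := hout_succ yb; have [c yc zc] := succ_hout yz.
    move: yc; rewrite yb => -[Ec]; subst c.
    by rewrite yz (hin_inj gI zc hb).
  rewrite E; case: existsP => [[b /andP[/eqP yb /eqP hb]]|nb].
    rewrite (bigD1 (enum_rank b)) //= big1 => [|c cb].
      by rewrite enum_rankK yb hb !eqxx addr0 !mulr1.
    rewrite yb hb; case: (eqVneq b (enum_val c)) => [Ec|nbc]; last first.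
      by rewrite -[Some _ == _]/(b == enum_val c) (negbTE nbc) mul0r.
    by case/eqP: cb; rewrite Ec enum_valK.
  rewrite big1 ?mulr0 // => b _.
  case: eqP => yb; last by rewrite mul0r.
  case: eqP => hb; last by rewrite mulr0.
  by case: nb; exists (enum_val b); rewrite yb hb !eqxx.
rewrite det_mulmx dZ mul1r det_1mulmxC; congr (\det (_ + _)).
(* Exactly one half-edge [h] has [a] as incoming arrow. It is not at an orbifold point, so [y h] is
   [o h], and [relation_other] identifies the entry. *)
rewrite -scalemxAr; congr (_ *: _); apply/matrixP => a b.
rewrite !mxE; have [h ha] := hin_exists gI BN (enum_val a).
rewrite (bigD1 (enum_rank h)) //= big1 => [|k kh].
  rewrite !mxE enum_rankK ha eqxx mul1r addr0 -(relation_other gI BN _ ha) /y.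
  by case: ifP => // /digon_hin; rewrite ha.
rewrite !mxE; case: eqP => [E|]; last by rewrite mul0r.
by case/eqP: kh; rewrite -(hin_inj gI E ha) enum_valK.
Qed.

(** * Weight and size of an interior polygon *)

Section Polygon.
Variable P : {set H}.
Hypotheses (polyP : P \in polygons g) (intP : @interior _ g P).

Let polygon_other h : h \in P -> D h || D (o h) -> o h \in P.
Proof.
move=> hP /orP[Dh|Dh].
  by rewrite (@polygons_turn _ g P (o h) h) // turnE oK Dh.
by rewrite -(@polygons_turn _ g P h (o h)) // turnE Dh.
Qed.

Let card_digons : #|[set h in P | D (o h)]| = #|[set h in P | D h]|.
Proof.
rewrite -(card_imset _ (can_inj oK)); congr #|pred_of_set _|.
apply/setP => h; apply/imsetP/idP => [[k + ->]|].
  rewrite !inE => /andP[kP Dk].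
  by rewrite Dk polygon_other ?Dk ?orbT.
rewrite inE => /andP[hP Dh]; exists (o h); last by rewrite oK.
by rewrite inE oK Dh polygon_other ?Dh.
Qed.

(** The weights neutralize the sides running to an orbifold point, whereas [nedges] discards those
    running back. [o] exchanges the two kinds within the polygon, so the counts agree. *)
Lemma prod_weight_polygon : \prod_(h in P) (- x h) = (- 'X) ^+ @nedges _ g P.
Proof.
have -> : @nedges _ g P = #|[set h in P | ~~ D (o h)]|.
  rewrite /nedges; apply/eqP; rewrite -(eqn_add2l #|[set h in P | D h]|).
  rewrite -{2}card_digons; apply/eqP.
  transitivity #|P|.
    rewrite -[RHS](cardsID (orbi g)); congr (_ + _)%N.
    by apply: eq_card => h; rewrite !inE.
  rewrite -[LHS](cardsID [set h | D (o h)]); congr (_ + _)%N.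
    by apply: eq_card => h; rewrite !inE.
  by apply: eq_card => h; rewrite !inE andbC.
rewrite -prodr_const [LHS](bigID (fun h => D (o h))) /= big1 ?mul1r => [|h /andP[_ Dh]].
  by apply: eq_big => [h|h /andP[_ /negbTE Dh]]; rewrite ?inE // /x Dh.
by rewrite /x Dh opprK.
Qed.

(** A half-edge at an orbifold point is not counted, but the other side of its edge is in the
    polygon and is. This lets the product start at [k = 1]. *)
Lemma nedges_gt0 : (0 < @nedges _ g P)%N.
Proof.
case/imsetP: (polyP) => h _ PE; have hP : h \in P by rewrite PE polygon_refl.
apply/card_gt0P; case Dh : (D h); [exists (o h) | exists h].
  by rewrite !inE polygon_other ?Dh //= -/(D (o h)) (digon_excl Dh).
by rewrite !inE hP /= -/(D h) Dh.
Qed.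

Lemma nedges_le : (@nedges _ g P <= #|H|)%N.
Proof. exact: max_card. Qed.

End Polygon.

Lemma det_relation :
  \det (1%:M + 'X *: rel_mx {poly int} (relation I)) =
    \prod_(1 <= k < #|half_edge g|.+1) (1 - (- 'X) ^+ k) ^+ @ninterior _ g k.
Proof.
rewrite det_relation_mx (det_turn_mx turn_sg_inj).
under [RHS]eq_bigr do rewrite /ninterior -prodr_const big_mkcond.
rewrite exchange_big /= [LHS]big_mkcond; apply: eq_bigr => P _ /=.
under [RHS]eq_bigr do rewrite inE andbA.
case: ifP => [/andP[Pp Pi]|nP]; last first.
  by rewrite big1 // => k _; rewrite nP.
rewrite prod_weight_polygon // -big_mkcond /=.
under eq_bigl do rewrite eq_sym.
(* The number of edges of a polygon lies in the range of [k], so each interior polygon contributes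
   to exactly one factor. *)
by rewrite big_nat1_eq nedges_gt0 // ltnS nedges_le.
Qed.

End RibbonDeterminant.

Theorem theorem7p3 (K : closedFieldType) (char_K : (2%:R : K) != 0)
    (Q : quiver) (I : pathalg Q K -> Prop) (Sp : {set vert Q})
    (skew_gentle_A : skew_gentle I Sp)
    (CA : 'M[{poly int}]_#|vert (sg_quiver Sp)|)
    (is_CA : is_qCartan (sg_ideal Sp I) CA)
    (CL : 'M[{poly int}]_#|vert Q|)
    (is_CL : is_qCartan I CL) :
  \det CA = \det CL /\
  \det CL =
    \prod_(1 <= k < #|half_edge (sg_ribbon I Sp)|.+1)
      (1 - (- 'X) ^+ k) ^+ ninterior (sg_ribbon I Sp) k.
Proof.
have [-> [N BN]] := det_gentle (proj1 skew_gentle_A) is_CL.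
split; first exact: det_skew_gentle.
exact: (det_relation skew_gentle_A BN).
Qed.
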